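(* Let $F$ be a continuous distribution function of a positive random variable with finite mean $\overline{\tau}$ and finite second moment $\sigma^2=\int_0^\infty2s(1-F(s))\,ds<\infty$. Let $M_{tr}$ and $M_{eq}$ be the transitional and equilibrium mean square displacements associated with $F$ (with velocity second moment $v^2$). Then $$M_{tr}(t)\sim M_{eq}(t)\sim\sigma^2v^2\frac t{\overline{\tau}}\quad\text{as }t\to\infty.$$
   Context: Given $F$ with $\overline{\tau}=\int_0^\infty(1-F(s))\,ds$: let $\tau_1,\tau_2,\dots$ be i.i.d. with distribution $F$, let $T_0\ge0$ be independent of the $\tau_i$, and $T_i=T_{i-1}+\tau_i$. Let $V_0,V_1,\dots$ be i.i.d. random vectors in $\mathbb{R}^d$, independent of the times, with $E[V_i]=0$ and $E[|V_i|^2]=v^2\in(0,\infty)$. Set $V(t)=V_0$ for $0\le t<T_0$, $V(t)=V_i$ for $T_{i-1}\le t<T_i$, $X(t)=\int_0^tV(s)\,ds$, $M(t)=E[|X(t)|^2]$. $M_{tr}$ is $M$ when $T_0=0$; $M_{eq}$ is $M$ when $T_0$ has distribution function $F_0(t)=\frac1{\overline{\tau}}\int_0^t(1-F(s))\,ds$. *)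

(* Defs.v *)
From HB Require Import structures.
From mathcomp Require Import all_boot all_order all_algebra.
From mathcomp Require Import all_classical all_reals all_analysis.
Set Implicit Arguments. Unset Strict Implicit. Unset Printing Implicit Defensive.
Import Order.TTheory GRing.Theory Num.Theory.
Import numFieldNormedType.Exports.
Local Open Scope classical_set_scope.
Local Open Scope ring_scope.

Definition taubar (R : realType) (F : R -> R) : \bar R :=
  (\int[@lebesgue_measure R]_(s in `[0%R, +oo[) (1 - F s)%:E)%E.

Definition sigma2 (R : realType) (F : R -> R) : \bar R :=
  (\int[@lebesgue_measure R]_(s in `[0%R, +oo[) (2 * s * (1 - F s))%:E)%E.

(* equilibrium distribution function F_0(t) = (1/taubar) int_0^t (1 - F s) ds
   (equal to 0 for t < 0, the interval being empty) *)
Definition F0 (R : realType) (F : R -> R) (t : R) : R :=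
  fine (\int[@lebesgue_measure R]_(s in `[0%R, t]) (1 - F s)%:E)%E / fine (taubar F).

(* Borel sigma-algebra on R^d = 'I_d -> R, generated by coordinate cylinders *)
Definition Rd_measurable (R : realType) (d : nat) : set (set ('I_d -> R)) :=
  <<s setT, [set A | exists (j : 'I_d) (B : set R), measurable B /\
                      A = [set x | B (x j)]] >>.

Definition events_of_R (T : Type) (R : realType) (X : T -> R) : set (set T) :=
  [set E | exists B : set R, measurable B /\ E = X @^-1` B].

Definition events_of_Rd (T : Type) (R : realType) (d : nat) (Y : T -> 'I_d -> R)
  : set (set T) :=
  [set E | exists A, Rd_measurable A /\ E = Y @^-1` A].

Definition mutually_independent (dT : measure_display) (T : measurableType dT)
  (R : realType) (P : probability T R) (I : eqType) (C : I -> set (set T)) : Prop :=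
  forall (s : seq I) (E : I -> set T), uniq s ->
    (forall i, i \in s -> C i (E i)) ->
    P (\big[setI/setT]_(i <- s) E i) = (\big[*%E/1%E]_(i <- s) P (E i))%E.

(* Renewal times: T_0 = T0, T_n = T0 + tau_1 + ... + tau_n, where
   [tau k] stands for tau_{k+1}. *)
Definition renewal_time (T : Type) (R : realType) (T0 : T -> R) (tau : nat -> T -> R)
  (n : nat) (w : T) : R := T0 w + \sum_(k < n) tau k w.

Definition seg_index (R : realType) (Tn : nat -> R) (t : R) : nat :=
  match pselect (exists n, t < Tn n) with
  | left h => ex_minn (P := fun n => t < Tn n) h
  | right _ => 0%N
  end.

(* V(t) = V_0 for t < T_0, V_i for T_{i-1} <= t < T_i *)
Definition velocity (T : Type) (R : realType) (d : nat) (T0 : T -> R)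
  (tau : nat -> T -> R) (V : nat -> T -> 'I_d -> R) (t : R) (w : T) : 'I_d -> R :=
  V (seg_index (fun n => renewal_time T0 tau n w) t) w.

Definition displacement (T : Type) (R : realType) (d : nat) (T0 : T -> R)
  (tau : nat -> T -> R) (V : nat -> T -> 'I_d -> R) (t : R) (w : T) : 'I_d -> R :=
  fun j => fine (\int[@lebesgue_measure R]_(s in `[0%R, t])
                    (velocity T0 tau V s w j)%:E)%E.

Definition msd (dT : measure_display) (T : measurableType dT) (R : realType)
  (P : probability T R) (d : nat) (T0 : T -> R) (tau : nat -> T -> R)
  (V : nat -> T -> 'I_d -> R) (t : R) : \bar R :=
  ('E_P[fun w => (\sum_(j < d) (displacement T0 tau V t w j) ^+ 2)%R])%E.

Definition rv_events (T : Type) (R : realType) (d : nat) (T0 : T -> R)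
  (tau : nat -> T -> R) (V : nat -> T -> 'I_d -> R) (i : option (nat + nat))
  : set (set T) :=
  match i with
  | None => events_of_R T0
  | Some (inl n) => events_of_R (tau n)
  | Some (inr n) => events_of_Rd (V n)
  end.

(* The standing assumptions of the model (except the law of T0):
   tau_i i.i.d. with distribution function F, V_i i.i.d. in R^d with mean 0 and
   E|V_i|^2 = v2 in (0,oo), and T0, (tau_i), (V_i) mutually independent. *)
Definition renewal_setup (dT : measure_display) (T : measurableType dT)
  (R : realType) (P : probability T R) (d : nat) (F : R -> R)
  (T0 : T -> R) (tau : nat -> T -> R) (V : nat -> T -> 'I_d -> R) (v2 : R) : Prop :=
  measurable_fun setT T0 /\
  (forall n, measurable_fun setT (tau n)) /\
  (forall n j, measurable_fun setT (fun w => V n w j)) /\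
  (forall n s, P [set w | tau n w <= s] = (F s)%:E) /\
  (forall n A, Rd_measurable A -> P (V n @^-1` A) = P (V 0%N @^-1` A)) /\
  (forall n j, ('E_P[fun w => V n w j])%E = 0%E) /\
  (forall n, ('E_P[fun w => (\sum_(j < d) (V n w j) ^+ 2)%R])%E = v2%:E) /\
  0 < v2 /\
  mutually_independent P (rv_events T0 tau V).

(* the filter "t -> +oo" on R, packaged as a filter_on for Landau notation *)
Definition pinfty_filter (R : realType) : filter_on R :=
  FilterType (pinfty_nbhs R) (@filter_filter R _ (@proper_pinfty_nbhs R)).

(* Main.v *)
(* Write T_n for the renewal times and L_n for the length of the n-th segment
   inside [0, t].  Velocities are centred and independent of each other and of the
   times, so cross terms vanish and M(t) = v^2 E[sum_n L_n^2].  No segment but the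
   one straddling t is truncated; cutting the waiting times at a level K makes that
   one harmless, and since {T_i <= t} is independent of tau_{i+1} (Wald's argument)
     m2(K) U - K^2 <= E[sum_n L_n^2] <= E[min(T_0, t)^2] + m2(t) U,
   where m1(K) = E[min(tau, K)], m2(K) = E[min(tau, K)^2] and U = sum_i P(T_i <= t).
   The same comparison for sum_n L_n = t gives t - 1 - E[min(T_0, t)^2] <= m1(t) U
   and m1(K) U <= t + K.  Letting t -> oo and then K -> oo, U ~ t / taubar and
   E[sum_n L_n^2] ~ sigma^2 t / taubar as soon as E[min(T_0, t)^2] = o(t).  For the
   equilibrium law this holds because s P(T_0 > s) <= taubar^-1 int_s^oo u (1 - F u)
   du, which tends to 0. *)
Require Import Defs.
From HB Require Import structures.
From mathcomp Require Import all_boot all_order all_algebra.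
From mathcomp Require Import all_classical all_reals all_analysis.
From mathcomp Require Import measurable_realfun ring lra.
Import Order.TTheory GRing.Theory Num.Theory.
Import numFieldNormedType.Exports.
Local Open Scope classical_set_scope.
Local Open Scope ring_scope.
Set Implicit Arguments.
Unset Strict Implicit.
Unset Printing Implicit Defensive.

Section measurable_comparison.
Context d (T : measurableType d) (R : realType).

Lemma measurable_set_ltr (f g : T -> R) : measurable_fun setT f ->
  measurable_fun setT g -> measurable [set w | f w < g w].
Proof.
move=> mf mg; have := measurable_fun_ltr mf mg.
by move=> /(_ measurableT [set true]); rewrite setTI; exact.
Qed.

Lemma measurable_set_ler (f g : T -> R) : measurable_fun setT f ->
  measurable_fun setT g -> measurable [set w | f w <= g w].
Proof.
move=> mf mg; have := measurable_fun_ler mf mg.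
by move=> /(_ measurableT [set true]); rewrite setTI; exact.
Qed.

End measurable_comparison.

Section nonneg_integral.
Local Open Scope ereal_scope.
Context d (T : measurableType d) (R : realType).
Variable mu : {measure set T -> \bar R}.
Import HBNNSimple.

(* No measurability of [f] and [g]: the displacement is only controlled almost
   surely, and nothing is known about it on the exceptional set. *)
Lemma ge0_le_integral_off_null (f g : T -> \bar R) (N : set T) :
  (forall x, 0 <= f x) -> (forall x, 0 <= g x) ->
  measurable N -> mu N = 0 -> (forall x, ~ N x -> f x <= g x) ->
  \int[mu]_x f x <= \int[mu]_x g x.
Proof.
move=> f0 g0 mN N0 fg; rewrite (ge0_integralTE mu f0) (ge0_integralTE mu g0).
apply: ge_ereal_sup => _ [h /= hf <-].
pose h' : {nnsfun T >-> R} := proj_nnsfun h (measurableC mN).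
have -> : sintegral mu h = sintegral mu h'.
  rewrite -!integralT_nnsfun; apply: ge0_ae_eq_integral;
    [by []|exact/measurable_EFinP|exact/measurable_EFinP|
    by move=> x _; rewrite lee_fin|by move=> x _; rewrite lee_fin|].
  exists N; split => // x /= xN; apply: contrapT => Nx; apply: xN => _.
    by rewrite /h' /= /proj_nnsfun /= mindicE mem_set// mulr1.
apply: ereal_sup_ubound; exists h' => // x.
rewrite /h' /=; rewrite /proj_nnsfun /= mindicE.
have [Nx|Nx] := pselect (N x).
  by rewrite memNset ?mulr0//= => /(_ Nx).
by rewrite mem_set// mulr1; apply: le_trans (hf x) (fg x Nx).
Qed.

Lemma ge0_eq_integral_off_null (f g : T -> \bar R) (N : set T) :
  (forall x, 0 <= f x) -> (forall x, 0 <= g x) ->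
  measurable N -> mu N = 0 -> (forall x, ~ N x -> f x = g x) ->
  \int[mu]_x f x = \int[mu]_x g x.
Proof.
by move=> f0 g0 mN N0 fg; apply/eqP; rewrite eq_le; apply/andP; split;
  apply: (ge0_le_integral_off_null _ _ mN N0) => // x /fg->.
Qed.

End nonneg_integral.

Section independence.
Context d (T : measurableType d) (R : realType) (P : probability T R).

Definition indep_rv (X Y : T -> R) := forall A B : set R,
  measurable A -> measurable B ->
  P (X @^-1` A `&` Y @^-1` B) = (P (X @^-1` A) * P (Y @^-1` B))%E.

Lemma indep_integralM (X Y : T -> R) : indep_rv X Y ->
  P.-integrable setT (EFin \o X) -> P.-integrable setT (EFin \o Y) ->
  P.-integrable setT (EFin \o (X \* Y)) ->
  (\int[P]_w (X w * Y w) = (\int[P]_w X w) * (\int[P]_w Y w))%R.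
Proof.
move=> XY iX iY iXY.
have mX : measurable_fun setT X by exact/measurable_EFinP/(measurable_int P iX).
have mY : measurable_fun setT Y by exact/measurable_EFinP/(measurable_int P iY).
pose X' : {mfun T >-> R} := HB.pack X (isMeasurableFun.Build _ _ _ _ X mX).
pose Y' : {mfun T >-> R} := HB.pack Y (isMeasurableFun.Build _ _ _ _ Y mY).
pose XY2 := fun w => (X w, Y w).
have mXY : measurable_fun setT XY2 by exact: measurable_fun_pair.
pose f (z : R * R) : \bar R := (z.1 * z.2)%:E.
have mf : measurable_fun setT f.
  by apply/measurable_EFinP; apply: measurable_funM.
pose XY' : {mfun T >-> (R * R)%type} := HB.pack XY2 (isMeasurableFun.Build _ _ _ _ XY2 mXY).
pose m1 := distribution P X'. pose m2 := distribution P Y'.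
pose m' := distribution P XY'.
have E (A : set (R * R)) : measurable A -> (m1 \x m2)%E A = m' A.
  apply: product_measure_unique => {}A B mA mB.
  by rewrite /m' /m1 /m2 /distribution/= /pushforward -XY.
have EI : (\int[m1 \x m2]_z f z = \int[P]_w (X w * Y w)%:E)%E.
  rewrite (eq_measure_integral m'); last by move=> A mA _; exact: E.
  by rewrite /m' /distribution integral_pushforward.
have If : (m1 \x m2)%E.-integrable setT f.
  apply/integrableP; split => //.
  rewrite (eq_measure_integral m'); last by move=> A mA _; exact: E.
  rewrite /m' /distribution ge0_integral_pushforward//.
    by have /integrableP[_] := iXY.
  by apply: measurableT_comp.
rewrite {1}/Rintegral -EI -integral12_prod_meas1// /fubini_F.
have m1X : (\int[m1]_x x%:E = \int[P]_w (X w)%:E)%E.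
  by rewrite /m1 /distribution integral_pushforward//=; exact/measurable_EFinP.
have m2Y : (\int[m2]_x x%:E = \int[P]_w (Y w)%:E)%E.
  by rewrite /m2 /distribution integral_pushforward//=; exact/measurable_EFinP.
have i1 : m1.-integrable setT EFin.
  apply: integrable_pushforward => //; exact/measurable_EFinP.
have i2 : m2.-integrable setT EFin.
  apply: integrable_pushforward => //; exact/measurable_EFinP.
under eq_integral do under eq_integral do rewrite /f /= EFinM.
under eq_integral do rewrite integralZl//.
rewrite m2Y -(@fineK _ (\int[P]_w (Y w)%:E)%E) ?integrable_fin_num//.
by rewrite integralZr// m1X fineM// integrable_fin_num.
Qed.

End independence.

Section mutual_independence.
Context d (T : measurableType d) (R : realType) (P : probability T R).

Section complementary_sigma_algebra.
Context (I : choiceType) (C : I -> set (set T)).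
Hypothesis mC : forall i E, C i E -> measurable E.
Hypothesis CT : forall i, C i setT.
Hypothesis CI : forall i, setI_closed (C i).
Hypothesis indC : mutually_independent P C.

Definition other_events (i : I) : set (set T) :=
  \bigcup_(j in [set j | j != i]) C j.

Let cylinders (i : I) : set (set T) := [set A | exists s E,
  [/\ uniq s, i \notin s, forall j, j \in s -> C j (E j)
    & A = \bigcap_(j in [set` s]) E j]].

Let cylindersI i : setI_closed (cylinders i).
Proof.
move=> _ _ [s [E [us nis CE ->]]] [s' [E' [us' nis' CE' ->]]].
pose F (s : seq I) (E : I -> set T) j := if j \in s then E j else setT.
exists (undup (s ++ s')), (fun j => F s E j `&` F s' E' j); split.
- exact: undup_uniq.
- by rewrite mem_undup mem_cat negb_or nis nis'.
- move=> j _; apply: CI; rewrite /F; case: ifPn => // js;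
    [exact: CE|exact: CE'].
- apply/seteqP; split=> w /=.
    move=> [H H'] j /=; rewrite /F => _; split.
      by case: ifPn => // js; exact: H.
    by case: ifPn => // js; exact: H'.
  move=> H; split=> j /= js.
    by have := H j; rewrite /= mem_undup mem_cat js /F js; case.
  by have := H j; rewrite /= mem_undup mem_cat js orbT /F js; case.
Qed.

Lemma mutually_independent_other i E B :
  <<s other_events i >> E -> C i B -> P (E `&` B) = (P E * P B)%E.
Proof.
move=> sE CB.
have mB := mC CB.
have mcyl A : <<s cylinders i >> A -> measurable A.
  apply: smallest_sub; first exact: sigma_algebra_measurable.
  move=> _ [s [F [us nis CF ->]]]; rewrite bigcap_seq.
  by rewrite big_seq; apply: bigsetI_measurable => j /CF /mC.
have {}sE : <<s cylinders i >> E.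
  move: E sE; apply: sub_smallest2r; first exact: smallest_sigma_algebra.
  move=> A [j /= ji CA]; exists [:: j], (fun=> A); split => //.
  - by rewrite inE eq_sym.
  - by move=> k; rewrite inE => /eqP->.
  - by apply/seteqP; split=> [w Aw k //|w]; apply; rewrite /= inE.
move: E sE; apply: (@dynkin_induction _ (g_sigma_algebraType (cylinders i))) => //.
- by rewrite setTI probability_setT mul1e.
- move=> _ [s [F [us nis CF ->]]]; rewrite bigcap_seq.
  pose F' j := if j == i then B else F j.
  have := @indC (i :: s) F'; rewrite /= nis us => /(_ isT).
  have F's (op : set T -> set T -> set T) idx :
      \big[op/idx]_(j <- s) F' j = \big[op/idx]_(j <- s) F j.
    by apply: eq_big_seq => j js; rewrite /F' ifN//; apply: contraNneq nis => <-.
  have FP : (\big[*%E/1%E]_(j <- s) P (F' j) = \big[*%E/1%E]_(j <- s) P (F j))%E.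
    by apply: eq_big_seq => j js; rewrite /F' ifN//; apply: contraNneq nis => <-.
  have F'i : F' i = B by rewrite /F' eqxx.
  rewrite !big_cons F's FP F'i setIC => indB.
  rewrite indB; first by rewrite muleC (@indC s F us CF).
  by move=> j; rewrite inE /F'; case: eqVneq => [->//|_ /=]; exact: CF.
- move=> S /mcyl mS IH.
  have E : P (B `\` (S : set T)) = (P B - P S * P B)%E.
    rewrite measureD//; last by rewrite ltey_eq fin_num_measure.
    by congr (_ - _)%E; rewrite setIC; exact: IH.
  have E' : P (~` (S : set T)) = (1 - P S)%E by rewrite probability_setC.
  rewrite setIC -setDE; apply: etrans E _; apply/esym.
  apply: etrans (congr1 (fun x => x * P B)%E E') _.
  by rewrite muleBl ?fin_num_measure ?mul1e// fin_num_adde_defr.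
- move=> F mF tF IH; rewrite setI_bigcupl.
  rewrite measure_semi_bigcup; last 3 first.
  + by move=> n; apply: measurableI => //; exact: (mcyl _ (mF n)).
  + exact: trivIset_setIr.
  + by apply: bigcupT_measurable => n; apply: measurableI => //; exact: (mcyl _ (mF n)).
  rewrite measure_semi_bigcup; last 3 first.
  + by move=> n; exact: (mcyl _ (mF n)).
  + by [].
  + by apply: bigcupT_measurable => n; exact: (mcyl _ (mF n)).
  rewrite muleC -(fineK (fin_num_measure P B mB)) -nneseriesZl//.
  by apply: eq_eseriesr => n _; apply: etrans (IH n) _; rewrite muleC fineK ?fin_num_measure.
Qed.

Lemma mutually_independent_rv i (X : g_sigma_algebraType (other_events i) -> R)
    (Y : T -> R) :
  measurable_fun setT X -> (forall B, measurable B -> C i (Y @^-1` B)) ->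
  indep_rv P X Y.
Proof.
move=> mX mY A B mA mB; apply: mutually_independent_other (mY _ mB).
by rewrite -[X in <<s _ >> X]setTI; exact: mX.
Qed.

Lemma other_measurable_fun i j (X : T -> R) : j != i ->
  (forall B, measurable B -> C j (X @^-1` B)) ->
  measurable_fun setT (X : g_sigma_algebraType (other_events i) -> R).
Proof.
move=> ji XC _ B mB; rewrite setTI; apply: sub_sigma_algebra.
by exists j => //; exact: XC.
Qed.

End complementary_sigma_algebra.

End mutual_independence.

Section truncated_moments.
Context (R : realType).
Notation mu := (@lebesgue_measure R).

Lemma integral_itv_2x (a : R) : 0 <= a ->
  (\int[mu]_(s in `[0%R, a]) (2 * s)%:E = (a ^+ 2)%:E)%E.
Proof.
rewrite le_eqVlt => /predU1P[<-|a0]; first by rewrite set_itv1 integral_set1 expr0n.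
rewrite (@continuous_FTC2 _ _ (fun x : R => x ^+ 2))//.
- by rewrite expr0n/= sube0.
- by apply: continuous_subspaceT; exact: mulrl_continuous.
- split=> /=.
  + by move=> x _; exact/derivable1_diffP.
  + by apply: cvg_at_right_filter; exact: exprn_continuous.
  + by apply: cvg_at_left_filter; exact: exprn_continuous.
- by move=> x _; rewrite derive1E exp_derive expr1 -[_ *: _]/(_ * _) mulr1.
Qed.

Lemma integral_itv_cst1 (a : R) : 0 <= a ->
  (\int[mu]_(s in `[0%R, a]) 1%:E = a%:E)%E.
Proof.
move=> a0; rewrite integral_cst//= mul1e lebesgue_measure_itv/= lte_fin.
by move: a0; rewrite le_eqVlt => /predU1P[<-|->]; rewrite ?ltxx// sube0.
Qed.

Lemma itv0_setI_lt (K x : R) : 0 <= x ->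
  `[0, K]%classic `&` `]-oo, x[ = if x <= K then `[0, x[%classic else `[0, K]%classic.
Proof.
move=> x0; case: ifPn => xK; apply/seteqP; split=> s /=; rewrite !in_itv/=.
- by move=> [/andP[-> _] ->].
- by move=> /andP[-> sx]; split => //; rewrite (le_trans (ltW sx) xK).
- by case.
- move=> /andP[-> sK]; split => //; rewrite (le_lt_trans sK)//.
  by rewrite ltNge.
Qed.

Section layer_cake.
Context d (T : measurableType d) (P : probability T R).
Variables (X : T -> R) (F : R -> R) (K : R) (g G : R -> R).
Hypotheses (mX : measurable_fun setT X) (X0 : forall w, 0 <= X w).
Hypothesis PX : forall s, P [set w | X w <= s] = (F s)%:E.
Hypotheses (K0 : 0 <= K) (mg : measurable_fun setT g).
Hypothesis g0 : forall s, 0 <= s -> 0 <= g s.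
Hypothesis intg : forall a, 0 <= a ->
  (\int[mu]_(s in `[0%R, a]) (g s)%:E = (G a)%:E)%E.

Let gt_indic (w : T) (s : R) : R := \1_(`]-oo, X w[) s.

Lemma integral_layer_cake :
  (\int[P]_w (G (Num.min (X w) K))%:E
   = \int[mu]_(s in `[0%R, K]) (g s * (1 - F s))%:E)%E.
Proof.
pose f (p : T * measurableTypeR R) : \bar R :=
  (g p.2 * (\1_(`[0%R, K]) p.2 * gt_indic p.1 p.2))%:E.
have mf : measurable_fun setT f.
  apply/measurable_EFinP; apply: measurable_funM.
    exact: (measurableT_comp mg).
  apply: measurable_funM.
    have m1 : measurable_fun setT (\1_(`[0%R, K]%classic) : R -> R).
      exact: measurable_indic.
    exact: (measurableT_comp m1).
  rewrite (_ : (fun _ => _) = \1_[set p : T * measurableTypeR R | p.2 < X p.1]).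
    apply: measurable_indic; apply: measurable_set_ltr => //.
    exact: measurableT_comp.
  by apply/funext => p; rewrite /gt_indic !indicE; congr (_%:R);
    apply/idP/idP; rewrite !inE/= in_itv.
have f0 p : (0 <= f p)%E.
  rewrite lee_fin /f; have [p0|p0] := leP 0 p.2.
    by rewrite /gt_indic !indicE mulr_ge0 ?g0// mulr_ge0.
  rewrite [\1_(`[_, _]) _]indicE memNset ?mul0r ?mulr0//=.
  by rewrite in_itv/= leNgt p0.
transitivity (\int[P]_w \int[mu]_s f (w, s))%E.
  apply: eq_integral => w _; rewrite /f /=.
  have -> : (fun s => (g s * (\1_(`[0%R, K]) s * gt_indic w s))%:E) =
     (EFin \o g) \_ (`[0%R, K] `&` `]-oo, X w[).
    apply/funext => s; rewrite patchE /gt_indic.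
    rewrite -[X in g s * X]/((\1_(`[0%R, K]) \* \1_(`]-oo, X w[)) s).
    rewrite -indicI indicE.
    by case: ifPn; rewrite ?mulr1 ?mulr0.
  rewrite -integral_mkcond itv0_setI_lt//.
  have [XK|KX] := leP (X w) K.
    by rewrite integral_itv_bndo_bndc ?intg//; apply/measurable_EFinP; exact: measurable_funTS.
  by rewrite intg.
rewrite (fubini_tonelli f)// [RHS]integral_mkcond; apply: eq_integral => s _.
rewrite patchE /f/=.
under eq_integral do rewrite mulrA EFinM.
have mE : measurable [set w | s < X w] by exact: measurable_set_ltr.
have PE : P [set w | s < X w] = (1 - F s)%:E.
  have -> : [set w | s < X w] = ~` [set w | X w <= s].
    by apply/seteqP; split=> w /=; rewrite ltNge => /negP.
  by rewrite probability_setC ?PX//; exact: measurable_set_ler.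
have E w : gt_indic w s = \1_[set w | s < X w] w.
  by rewrite /gt_indic !indicE; congr (_%:R); apply/idP/idP; rewrite !inE/= in_itv.
under eq_integral do rewrite E.
have gs0 : 0 <= g s * \1_(`[0%R, K]) s.
  have [p0|p0] := leP 0 s; first by rewrite indicE mulr_ge0 ?g0.
  by rewrite indicE memNset ?mulr0//= in_itv/= leNgt p0.
rewrite ge0_integralZl//; last first.
  exact/measurable_EFinP/measurable_indic.
rewrite integral_indic// setIT.
apply: etrans (congr1 (mule _) PE) _.
rewrite -EFinM indicE; case: ifPn => _; last by rewrite mulr0 mul0r.
by rewrite mulr1.
Qed.

End layer_cake.

Definition trunc_mean (F : R -> R) (K : R) : R :=
  \int[mu]_(s in `[0, K]) (1 - F s).

Definition trunc_sqr (F : R -> R) (K : R) : R :=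
  \int[mu]_(s in `[0, K]) (2 * s * (1 - F s)).

Section moments.
Context d (T : measurableType d) (P : probability T R).
Variables (X : T -> R) (F : R -> R) (K : R).
Hypotheses (mX : measurable_fun setT X) (X0 : forall w, 0 <= X w).
Hypothesis PX : forall s, P [set w | X w <= s] = (F s)%:E.
Hypothesis K0 : 0 <= K.

Lemma expectation_min : \int[P]_w (Num.min (X w) K) = trunc_mean F K.
Proof.
rewrite /trunc_mean /Rintegral.
rewrite (@integral_layer_cake _ _ _ _ F _ (cst 1) id)//.
  by congr fine; apply: eq_integral => s _ /=; rewrite mul1r.
by move=> a; exact: integral_itv_cst1.
Qed.

Lemma expectation_sqr_min : \int[P]_w (Num.min (X w) K ^+ 2) = trunc_sqr F K.
Proof.
rewrite /trunc_sqr /Rintegral.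
rewrite (@integral_layer_cake _ _ _ _ F _ (fun s => 2 * s) (fun x => x ^+ 2))//.
- exact: measurable_funM.
- by move=> s s0; rewrite mulr_ge0.
- by move=> a; exact: integral_itv_2x.
Qed.

End moments.

Lemma ge0_integral_itvcy_approx (h : R -> R) : measurable_fun setT h ->
  (forall s, 0 <= s -> 0 <= h s) ->
  (\int[mu]_(s in `[0%R, +oo[) (h s)%:E < +oo)%E ->
  forall e, 0 < e -> exists K, 0 < K /\
    fine (\int[mu]_(s in `[0%R, +oo[) (h s)%:E)%E - e
      <= \int[mu]_(s in `[0, K]) h s.
Proof.
move=> mh h0 hoo e e0.
pose D (n : nat) : set R := `[0%R, n.+1%:R]%classic.
have DE : \bigcup_n D n = `[0%R, +oo[%classic.
  apply/seteqP; split=> s /=; rewrite !in_itv/= ?andbT.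
    by move=> [n _]; rewrite /D/= in_itv/= => /andP[].
  move=> s0; exists (Num.truncn s) => //; rewrite /D/= in_itv/= s0/=.
  exact/ltW/truncnS_gt.
have cv : (\int[mu]_(s in D i) (h s)%:E @[i --> \oo] -->
    \int[mu]_(s in `[0%R, +oo[) (h s)%:E)%E.
  rewrite -DE; apply: ge0_nondecreasing_set_cvg_integral => //.
  - apply/nondecreasing_seqP => n; apply/subsetPset => s; rewrite /D/= !in_itv/=.
    by move=> /andP[->] /le_trans; apply; rewrite ler_nat.
  - by move=> i; exact: measurable_itv.
  - by move=> i; apply/measurable_EFinP; exact: measurable_funTS.
  - by move=> i s; rewrite /D/= in_itv/= => /andP[s0 _]; rewrite lee_fin h0.
have ge0D : (0 <= \int[mu]_(s in `[0%R, +oo[) (h s)%:E)%E.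
  by apply: integral_ge0 => s /=; rewrite in_itv/= andbT => s0; rewrite lee_fin h0.
have fin : (\int[mu]_(s in `[0%R, +oo[) (h s)%:E)%E \is a fin_num.
  by rewrite ge0_fin_numE.
rewrite -(fineK fin) in cv; move/fine_cvgP : cv => [_ cv].
have /cvgrPdist_le /(_ e e0) [N _ /(_ N (leqnn N)) /=] := cv.
move=> H; exists N.+1%:R; split; first by rewrite ltr0n.
by rewrite /Rintegral lerBlDl -lerBlDr; apply: le_trans H; exact: ler_norm.
Qed.

End truncated_moments.

Section segment_lengths.
Context (R : realType).
Notation mu := (@lebesgue_measure R).
Implicit Types (Tn : nat -> R) (t : R).

(* Length of the n-th segment inside [0, t], with the convention T_{-1} = 0. *)
Definition seg_len Tn t (n : nat) : R :=
  Num.min (Tn n) t - (if n is k.+1 then Num.min (Tn k) t else 0).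

Lemma sum_seg_len Tn t m :
  \sum_(n < m.+1) seg_len Tn t n = Num.min (Tn m) t.
Proof.
elim: m => [|m IH]; first by rewrite big_ord1 /seg_len subr0.
by rewrite big_ord_recr/= IH /seg_len addrC subrK.
Qed.

Lemma sum_seg_lenS Tn t m :
  \sum_(i < m) seg_len Tn t i.+1 = Num.min (Tn m) t - Num.min (Tn 0) t.
Proof.
by rewrite -(sum_seg_len _ _ m) big_ord_recl/= {2}/seg_len subr0 addrC addKr.
Qed.

Section pathwise_bounds.
Variables (Tn : nat -> R) (t : R).
Hypotheses (t0 : 0 <= t) (Tn0 : forall n, 0 <= Tn n)
  (Tnnd : forall n, Tn n <= Tn n.+1).

Lemma seg_len_ge0 n : 0 <= seg_len Tn t n.
Proof.
case: n => [|n]; rewrite /seg_len; first by rewrite subr0 le_min Tn0 t0.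
rewrite subr_ge0; have ? := Tnnd n.
by case: (leP (Tn n) t) => ?; case: (leP (Tn n.+1) t) => ?; lra.
Qed.

Lemma seg_len_le n : seg_len Tn t n <= t.
Proof.
case: n => [|n]; rewrite /seg_len; first by rewrite subr0 ge_min lexx orbT.
have ? := t0; have ? := Tn0 n; have ? := Tn0 n.+1.
by case: (leP (Tn n) t) => ?; case: (leP (Tn n.+1) t) => ?; lra.
Qed.

Lemma sum_seg_len_sqr m : \sum_(n < m.+1) seg_len Tn t n ^+ 2 <= t ^+ 2.
Proof.
apply: (@le_trans _ _ (t * \sum_(n < m.+1) seg_len Tn t n)).
  rewrite mulr_sumr; apply: ler_sum => n _; rewrite expr2 ler_wpM2r//.
    exact: seg_len_ge0.
  exact: seg_len_le.
by rewrite sum_seg_len expr2 ler_wpM2l// ge_min lexx orbT.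
Qed.

Lemma seg_lenS_le i :
  seg_len Tn t i.+1 <= Num.min (Tn i.+1 - Tn i) t * (Tn i <= t)%R%:R.
Proof.
have ? := t0; have ? := Tnnd i; have ? := Tn0 i; rewrite /seg_len.
case: (leP (Tn i) t) => ?; case: (leP (Tn i.+1) t) => ?; rewrite ?mulr1 ?mulr0;
  by case: (leP (Tn i.+1 - Tn i) t) => ?; lra.
Qed.

Lemma seg_lenS_sqr_le i :
  seg_len Tn t i.+1 ^+ 2 <= Num.min (Tn i.+1 - Tn i) t ^+ 2 * (Tn i <= t)%R%:R.
Proof.
have := seg_lenS_le i; have := seg_len_ge0 i.+1; move: (seg_len _ _ _) => l l0.
case: (_ <= t); rewrite ?mulr1 ?mulr0 => H; last by have -> : l = 0 by [lra]; rewrite expr0n.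
by rewrite lerXn2r// nnegrE ?(le_trans l0).
Qed.

(* The right-hand defect is the indicator of the segment straddling [t], the only
   one that may be incomplete; summed over [i] it telescopes. *)
Lemma seg_lenS_ge K i : 0 <= K ->
  Num.min (Tn i.+1 - Tn i) K * (Tn i <= t)%R%:R
    <= seg_len Tn t i.+1 + K * ((Tn i <= t)%R%:R - (Tn i.+1 <= t)%R%:R).
Proof.
move=> K0; have ? := t0; have ? := Tnnd i; have ? := Tn0 i; rewrite /seg_len.
case: (leP (Tn i) t) => ?; case: (leP (Tn i.+1) t) => ? /=;
  by case: (leP (Tn i.+1 - Tn i) K) => ?; lra.
Qed.

Lemma seg_lenS_sqr_ge K i : 0 <= K ->
  Num.min (Tn i.+1 - Tn i) K ^+ 2 * (Tn i <= t)%R%:R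
    <= seg_len Tn t i.+1 ^+ 2 + K ^+ 2 * ((Tn i <= t)%R%:R - (Tn i.+1 <= t)%R%:R).
Proof.
move=> K0; have ? := t0; have ? := Tnnd i; have ? := Tn0 i; rewrite /seg_len.
case: (leP (Tn i) t) => ?; case: (leP (Tn i.+1) t) => ? /=;
  by case: (leP (Tn i.+1 - Tn i) K) => ?; nra.
Qed.

End pathwise_bounds.

Lemma seg_index_telescope Tn (x : nat -> R) (s : R) m :
  (forall n k, (n <= k)%N -> Tn n <= Tn k) -> s < Tn m ->
  x (seg_index Tn s) = \sum_(n < m.+1)
    x n * ((s < Tn n)%R%:R - (if nat_of_ord n is k.+1 then (s < Tn k)%R%:R else 0)).
Proof.
move=> nd sm; rewrite /seg_index; case: pselect => [h|]; last first.
  by move=> /(_ (ex_intro _ m sm)).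
case: ex_minnP => N sN minN.
have Nm : (N < m.+1)%N by rewrite ltnS minN.
rewrite (bigD1 (Ordinal Nm))//= sN big1 ?addr0.
  case: (N) minN => [|k] minN; first by rewrite subr0 mulr1.
  have /negbTE -> : ~~ (s < Tn k) by apply/negP => /minN; rewrite ltnn.
  by rewrite subr0 mulr1.
move=> [n nm] /=; rewrite -val_eqE/= => nN.
have [{}nN|Nn|] := ltngtP n N; last by move=> e; rewrite e eqxx in nN.
  have /negbTE -> : ~~ (s < Tn n) by apply/negP => /minN; rewrite leqNgt nN.
  case: n nN {nm} => [|k] kN; first by rewrite subr0 mulr0.
  have /negbTE -> : ~~ (s < Tn k) by apply/negP => /minN; rewrite leqNgt (ltn_trans _ kN).
  by rewrite subrr mulr0.
rewrite (lt_le_trans sN (nd N n (ltnW Nn))).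
case: n Nn {nm nN} => // k Nk.
by rewrite (lt_le_trans sN (nd N k Nk)) subrr mulr0.
Qed.

Let lt_indic (a s : R) : R := (s < a)%R%:R.

Let lt_indicE a : lt_indic a = \1_(`]-oo, a[%classic) :> (R -> R).
Proof.
apply/funext => s; rewrite /lt_indic indicE; congr ((nat_of_bool _)%:R).
by apply/idP/idP; rewrite inE/= in_itv.
Qed.

Let integrable_lt_indic t a : mu.-integrable `[0, t] (EFin \o lt_indic a).
Proof.
apply: measurable_bounded_integrable => //=.
- by rewrite lebesgue_measure_itv/= lte_fin; case: ifP => _; rewrite ?ltry// -EFinB ltry.
- by rewrite lt_indicE; exact: measurable_indic.
- exists 1; split => // M M1 s _ /=; rewrite /lt_indic.
  case: (s < a) => /=; rewrite ?normr1 ?normr0 ltW//.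
  by rewrite (lt_trans ltr01).
Qed.

Let integral_lt_indic t a : 0 <= t -> 0 <= a ->
  (\int[mu]_(s in `[0%R, t]) (lt_indic a s)%:E = (Num.min a t)%:E)%E.
Proof.
move=> t0 a0; rewrite lt_indicE integral_indic//= setIC itv0_setI_lt//.
case: leP => ?; rewrite lebesgue_measure_itv/= lte_fin sube0; case: ltP => //.
  by move=> ?; congr EFin; lra.
by move=> ?; congr EFin; lra.
Qed.

Lemma integral_seg_index Tn (x : nat -> R) t m : 0 <= t ->
  (forall n, 0 <= Tn n) -> (forall n k, (n <= k)%N -> Tn n <= Tn k) -> t < Tn m ->
  (\int[mu]_(s in `[0%R, t]) (x (seg_index Tn s))%:E =
   (\sum_(n < m.+1) x n * seg_len Tn t n)%:E)%E.
Proof.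
move=> t0 Tn0 nd tm.
pose pre n s : R := if n is k.+1 then lt_indic (Tn k) s else 0.
have ipre n : mu.-integrable `[0, t] (EFin \o pre n).
  case: n => [|n]; [exact: integrable0|exact: integrable_lt_indic].
pose f n s := x n * (lt_indic (Tn n) s - pre n s).
have iB n : mu.-integrable `[0, t] (EFin \o (fun s => lt_indic (Tn n) s - pre n s)).
  have := @integrableB _ _ _ mu `[0%R, t] (measurable_itv _) _ _
    (integrable_lt_indic t (Tn n)) (ipre n).
  exact.
have if_ n : mu.-integrable `[0, t] (EFin \o f n).
  have := @integrableZl _ _ _ mu `[0%R, t] (measurable_itv _) (x n) _ (iB n).
  exact.
transitivity (\int[mu]_(s in `[0%R, t]) \sum_(n < m.+1) (f n s)%:E)%E.
  apply: eq_integral => s; rewrite inE/= in_itv/= => /andP[s0 st].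
  rewrite sumEFin; congr EFin; rewrite (@seg_index_telescope _ _ _ m)//.
  exact: le_lt_trans tm.
rewrite integral_sum//; last by move=> n; exact: if_.
rewrite -sumEFin; apply: eq_bigr => -[n nm] _ /=.
rewrite /f; under eq_integral do rewrite EFinM.
rewrite integralZl//; last exact: iB.
rewrite (@integralB_EFin _ _ _ mu `[0%R, t] _ _ _ (integrable_lt_indic _ _) (ipre n))//.
rewrite integral_lt_indic// /seg_len /pre; case: n nm => [|n] nm.
  by rewrite integral0 sube0 subr0 EFinM.
by rewrite integral_lt_indic// -EFinB EFinM.
Qed.

End segment_lengths.

Section bounded_random_variables.
Context d (T : measurableType d) (R : realType).
Implicit Types (f g : T -> R).

Definition bounded_rv f :=
  measurable_fun setT f /\ exists M, forall w, `|f w| <= M.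

Lemma bounded_rv_cst r : bounded_rv (cst r).
Proof. by split=> //; exists `|r|. Qed.

Lemma bounded_rvD f g : bounded_rv f -> bounded_rv g ->
  bounded_rv (fun w => f w + g w).
Proof.
move=> [mf [M fM]] [mg [N gN]]; split; first exact: measurable_funD.
by exists (M + N) => w; rewrite (le_trans (ler_normD _ _))// lerD.
Qed.

Lemma bounded_rvN f : bounded_rv f -> bounded_rv (fun w => - f w).
Proof.
move=> [mf [M fM]]; split; first exact: measurableT_comp.
by exists M => w; rewrite normrN.
Qed.

Lemma bounded_rvB f g : bounded_rv f -> bounded_rv g ->
  bounded_rv (fun w => f w - g w).
Proof. by move=> bf /bounded_rvN; exact: bounded_rvD. Qed.

Lemma bounded_rvM f g : bounded_rv f -> bounded_rv g ->
  bounded_rv (fun w => f w * g w).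
Proof.
move=> [mf [M fM]] [mg [N gN]]; split; first exact: measurable_funM.
by exists (M * N) => w; rewrite normrM ler_pM.
Qed.

Lemma bounded_rvX2 f : bounded_rv f -> bounded_rv (fun w => f w ^+ 2).
Proof. by move=> bf; have := bounded_rvM bf bf. Qed.

Lemma bounded_rv_sum n (f : 'I_n -> T -> R) : (forall i, bounded_rv (f i)) ->
  bounded_rv (fun w => \sum_(i < n) f i w).
Proof.
move=> bf; rewrite (_ : (fun _ => _) = \sum_(i < n) f i); last first.
  by apply/funext => w; rewrite fct_sumE.
apply: (big_ind bounded_rv) => //; first exact: bounded_rv_cst.
by move=> g h; exact: bounded_rvD.
Qed.

Lemma bounded_rv_le (X : T -> R) (t : R) : measurable_fun setT X ->
  bounded_rv (fun w => (X w <= t)%R%:R).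
Proof.
move=> mX; split; last by exists 1 => w; rewrite normr_nat lern1 leq_b1.
rewrite (_ : (fun _ => _) = \1_[set w | X w <= t]).
  by apply: measurable_indic; exact: measurable_set_ler.
by apply/funext => w; rewrite indicE; congr ((nat_of_bool _)%:R);
  apply/idP/idP; rewrite inE.
Qed.

Lemma bounded_rv_min (X : T -> R) (K : R) : measurable_fun setT X -> (forall w, 0 <= X w) ->
  0 <= K -> bounded_rv (fun w => Num.min (X w) K).
Proof.
move=> mX X0 K0; split; first exact: measurable_minr.
exists K => w; rewrite ger0_norm ?ge_min ?lexx ?orbT//.
by rewrite le_min X0.
Qed.

Lemma bounded_rv_seg_len (S : nat -> T -> R) t n :
  (forall k, (k <= n)%N -> measurable_fun setT (S k)) ->
  (forall k w, 0 <= S k w) -> 0 <= t ->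
  bounded_rv (fun w => seg_len (S^~ w) t n).
Proof.
move=> mS S0 t0; rewrite /seg_len; apply: bounded_rvB.
  by apply: bounded_rv_min => //; exact: mS.
case: n mS => [|n] mS; first exact: bounded_rv_cst.
by apply: bounded_rv_min => //; exact: mS.
Qed.

Variable P : probability T R.

Lemma bounded_rv_integrable f : bounded_rv f -> P.-integrable setT (EFin \o f).
Proof.
move=> [mf [M fM]]; apply: measurable_bounded_integrable => //.
  by apply: (@le_lt_trans _ _ 1%E); [exact: probability_le1|exact: ltry].
by exists M; split=> [|N MN w _ /=]; rewrite ?num_real// (le_trans (fM w))// ltW.
Qed.

Lemma integrable_bounded_rvM f g : P.-integrable setT (EFin \o f) ->
  bounded_rv g -> P.-integrable setT (EFin \o (fun w => f w * g w)).
Proof.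
move=> ig [mf [M fM]].
have -> : EFin \o (fun w => f w * g w) = ((EFin \o g) \* (EFin \o f))%E.
  by apply/funext => w /=; rewrite mulrC EFinM.
apply: integrableMr => //.
by exists M; split=> [|N MN w _ /=]; rewrite ?num_real// (le_trans (fM w))// ltW.
Qed.

Lemma Rintegral_sum n (f : 'I_n -> T -> R) :
  (forall i, P.-integrable setT (EFin \o f i)) ->
  \int[P]_w (\sum_(i < n) f i w) = \sum_(i < n) \int[P]_w f i w.
Proof.
move=> intf; rewrite /Rintegral.
under eq_integral do rewrite -sumEFin.
rewrite integral_sum// sum_fine// => i _.
exact: (integrable_fin_num measurableT (intf i)).
Qed.

Lemma Rintegral_probability_cst r : \int[P]_w r = r.
Proof. by rewrite Rintegral_cst//= probability_setT mulr1. Qed.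

End bounded_random_variables.

Section renewal_events.
Context (dT : measure_display) (T : measurableType dT) (R : realType) (d : nat).
Variables (T0 : T -> R) (tau : nat -> T -> R) (V : nat -> T -> 'I_d -> R).
Hypotheses (mT0 : measurable_fun setT T0)
  (mtau : forall n, measurable_fun setT (tau n))
  (mV : forall n j, measurable_fun setT (fun w => V n w j)).

Let C := rv_events T0 tau V.

Lemma rv_events_measurable i E : C i E -> measurable E.
Proof.
have mR (X : T -> R) : measurable_fun setT X -> events_of_R X E -> measurable E.
  by move=> mX [B [mB ->]]; rewrite -[X in measurable X]setTI; exact: mX.
case: i => [[n|n]|] /=; [exact: mR|move=> [A [mA ->]]|exact: mR].
move: A mA; rewrite /Rd_measurable.
apply: (@smallest_sub _ _ _ [set A : set ('I_d -> R) | measurable (V n @^-1` A)]).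
  split=> [|A /= mA|A /= mA] /=.
  - by rewrite preimage_set0.
  - by rewrite setTD preimage_setC; exact: measurableC.
  - by rewrite preimage_bigcup; exact: bigcupT_measurable.
move=> _ [j [B [mB ->]]] /=; rewrite -[X in measurable X]setTI.
exact: (mV n j).
Qed.

Lemma rv_eventsT i : C i setT.
Proof.
case: i => [[n|n]|] /=; [by exists setT| |by exists setT].
by exists setT; split => //; exact: (@measurableT _ (g_sigma_algebraType _)).
Qed.

Lemma rv_eventsI i : setI_closed (C i).
Proof.
case: i => [[n|n]|] _ _ [A [mA ->]] [B [mB ->]];
  exists (A `&` B); split => //; try exact: measurableI.
exact: (@measurableI _ (g_sigma_algebraType _)).
Qed.

Lemma rv_events_velocity n j B : measurable B ->
  C (Some (inr n)) ((fun w => V n w j) @^-1` B).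
Proof.
move=> mB; exists [set x | B (x j)]; split => //.
by apply: sub_sigma_algebra; exists j, B.
Qed.

Let Ct i := g_sigma_algebraType (other_events C i).

Lemma other_tau i n : Some (inl n) != i ->
  measurable_fun setT (tau n : Ct i -> R).
Proof.
by move=> ni; apply: (other_measurable_fun ni) => B mB; exists B.
Qed.

Lemma other_velocity i n j : Some (inr n) != i ->
  measurable_fun setT ((fun w => V n w j) : Ct i -> R).
Proof.
by move=> ni; apply: (other_measurable_fun ni) => B mB; exact: rv_events_velocity.
Qed.

Lemma other_renewal_time i n : None != i ->
  (forall k, (k < n)%N -> Some (inl k) != i) ->
  measurable_fun setT (renewal_time T0 tau n : Ct i -> R).
Proof.
move=> Ni ni; apply: measurable_funD.
  by apply: (other_measurable_fun Ni) => B mB; exists B.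
by apply: measurable_sum => k; apply: other_tau; exact: ni.
Qed.

End renewal_events.

Section renewal_process.
Context (dT : measure_display) (T : measurableType dT) (R : realType)
  (P : probability T R) (d : nat).
Variables (F : R -> R) (T0 : T -> R) (tau : nat -> T -> R)
  (V : nat -> T -> 'I_d -> R) (v2 : R).
Hypothesis setup : renewal_setup P F T0 tau V v2.
Hypotheses (T0ge0 : forall w, 0 <= T0 w) (tau_ge0 : forall n w, 0 <= tau n w).
Variable t : R.
Hypothesis t0 : 0 <= t.

Let mT0 : measurable_fun setT T0. Proof. by case: setup. Qed.
Let mtau n : measurable_fun setT (tau n). Proof. by case: setup => _ [+ _]; exact. Qed.
Let mV n j : measurable_fun setT (fun w => V n w j).
Proof. by case: setup => _ [_ [+ _]]; exact. Qed.
Let tauF n s : P [set w | tau n w <= s] = (F s)%:E.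
Proof. by case: setup => _ [_ [_ [+ _]]]; exact. Qed.
Let indC : mutually_independent P (rv_events T0 tau V).
Proof. by case: setup => _ [_ [_ [_ [_ [_ [_ [_ ]]]]]]]. Qed.

Let S n w := renewal_time T0 tau n w.
Let ind n w : R := (S n w <= t)%R%:R.
Let L n w := seg_len (S^~ w) t n.

Let mC := rv_events_measurable mT0 mtau mV.
Let CT := rv_eventsT T0 tau V.
Let CI := @rv_eventsI _ _ _ _ T0 tau V.

Let S0 n w : 0 <= S n w.
Proof. by rewrite addr_ge0// sumr_ge0. Qed.

Let SS n w : S n.+1 w - S n w = tau n w.
Proof. by rewrite /S /renewal_time big_ord_recr/= addrA [LHS]addrC addKr. Qed.

Let Snd n w : S n w <= S n.+1 w.
Proof. by rewrite -subr_ge0 SS. Qed.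

Let mS n : measurable_fun setT (S n).
Proof. by apply: measurable_funD => //; exact: measurable_sum. Qed.

Let bind n : bounded_rv (ind n). Proof. exact: bounded_rv_le. Qed.
Let bL n : bounded_rv (L n). Proof. exact: bounded_rv_seg_len. Qed.
Let bmin n K : 0 <= K -> bounded_rv (fun w => Num.min (tau n w) K).
Proof. by move=> K0; exact: bounded_rv_min. Qed.

Definition renewal_prob n : R := \int[P]_w (renewal_time T0 tau n w <= t)%R%:R.
Let u := renewal_prob.

Lemma renewal_probE n : P [set w | renewal_time T0 tau n w <= t] = (u n)%:E.
Proof.
rewrite /u /renewal_prob /Rintegral fineK; last first.
  by apply: (integrable_fin_num measurableT); exact: (bounded_rv_integrable P (bind n)).
have mE : measurable [set w | S n w <= t] by exact: measurable_set_ler.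
rewrite -[LHS]/(P [set w | S n w <= t]) -[X in P X]setIT -integral_indic//.
apply: eq_integral => w _; rewrite indicE; congr ((nat_of_bool _)%:R%:E).
by apply/idP/idP; rewrite inE.
Qed.

Lemma renewal_prob_ge0 n : 0 <= u n.
Proof. by apply: Rintegral_ge0. Qed.

Lemma renewal_prob_nonincr n : u n.+1 <= u n.
Proof.
apply: le_Rintegral => //; [exact: (bounded_rv_integrable P (bind n.+1))
  |exact: (bounded_rv_integrable P (bind n))|move=> w _].
rewrite ler_nat; case: (leP (renewal_time _ _ n.+1 w)) => // St.
by rewrite (le_trans (Snd n w) St).
Qed.

Let tau_independent n (g : R -> R) : measurable_fun setT g ->
  bounded_rv (fun w => g (tau n w)) ->
  \int[P]_w (g (tau n w) * ind n w) = (\int[P]_w g (tau n w)) * u n.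
Proof.
move=> mg bg; apply/esym; rewrite mulrC.
under [RHS]eq_Rintegral do rewrite mulrC.
apply/esym; apply: indep_integralM.
- apply: (mutually_independent_rv mC CT CI indC (i := Some (inl n))).
    apply: (proj1 (@bounded_rv_le _ (g_sigma_algebraType
      (other_events (rv_events T0 tau V) (Some (inl n)))) R (S n) t _)).
    apply: other_renewal_time => // k kn; apply/eqP => -[kE].
    by rewrite kE ltnn in kn.
  by move=> B mB; exists (g @^-1` B); split => //; rewrite -[X in measurable X]setTI; exact: mg.
- exact: bounded_rv_integrable.
- exact: bounded_rv_integrable.
- exact: (bounded_rv_integrable P (bounded_rvM (bind n) bg)).
Qed.

Lemma wald_min n K : 0 <= K ->
  \int[P]_w (Num.min (tau n w) K * ind n w) = trunc_mean F K * u n.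
Proof.
move=> K0; rewrite (@tau_independent n (fun x => Num.min x K))//; last 2 first.
  exact: measurable_minr.
  exact: bmin.
by rewrite (expectation_min (F := F)).
Qed.

Lemma wald_sqr_min n K : 0 <= K ->
  \int[P]_w (Num.min (tau n w) K ^+ 2 * ind n w) = trunc_sqr F K * u n.
Proof.
move=> K0; rewrite (@tau_independent n (fun x => Num.min x K ^+ 2))//; last 2 first.
  by apply: measurable_funX; exact: measurable_minr.
  exact/bounded_rvX2/bmin.
by rewrite (expectation_sqr_min (F := F)).
Qed.

Definition renewal_sum m : R := \sum_(i < m) u i.
Let U := renewal_sum.

Let wald_sum m K : 0 <= K ->
  \int[P]_w (\sum_(i < m) Num.min (tau i w) K * ind i w) = trunc_mean F K * U m.
Proof.
move=> K0; rewrite Rintegral_sum => [|i].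
  by rewrite mulr_sumr; apply: eq_bigr => i _; exact: wald_min.
by apply: bounded_rv_integrable; apply: bounded_rvM => //; exact: bmin.
Qed.

Let wald_sum_sqr m K : 0 <= K ->
  \int[P]_w (\sum_(i < m) Num.min (tau i w) K ^+ 2 * ind i w) = trunc_sqr F K * U m.
Proof.
move=> K0; rewrite Rintegral_sum => [|i].
  by rewrite mulr_sumr; apply: eq_bigr => i _; exact: wald_sqr_min.
by apply: bounded_rv_integrable; apply: bounded_rvM => //; exact/bounded_rvX2/bmin.
Qed.

Let telescope_ind m w : \sum_(i < m) (ind i w - ind i.+1 w) <= 1.
Proof.
have -> : \sum_(i < m) (ind i w - ind i.+1 w) = ind 0 w - ind m w.
  elim: m => [|m IH]; first by rewrite big_ord0 subrr.
  by rewrite big_ord_recr/= IH addrA subrK.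
rewrite lerBlDr; apply: (@le_trans _ _ 1); first by rewrite lern1 leq_b1.
by rewrite lerDl.
Qed.

Let bsum m K p : 0 <= K ->
  bounded_rv (fun w => \sum_(i < m) Num.min (tau i w) K ^+ p.+1 * ind i w).
Proof.
move=> K0; apply: bounded_rv_sum => i; apply: bounded_rvM => //.
elim: p => [|p IH]; first exact: bmin.
rewrite (_ : (fun _ => _) = fun w => Num.min (tau i w) K * Num.min (tau i w) K ^+ p.+1).
  by apply: bounded_rvM => //; exact: bmin.
by apply/funext => w; rewrite -exprS.
Qed.

Let bsum1 m K : 0 <= K ->
  bounded_rv (fun w => \sum_(i < m) Num.min (tau i w) K * ind i w).
Proof. exact: (@bsum m K 0%N). Qed.

Lemma renewal_sum_upper m K : 0 <= K -> trunc_mean F K * U m <= t + K.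
Proof.
move=> K0; rewrite -wald_sum// -[leRHS](Rintegral_probability_cst P).
apply: le_Rintegral => //; [exact: (bounded_rv_integrable P (bsum1 m K0))
  |exact: (bounded_rv_integrable P (bounded_rv_cst T _))|move=> w _].
apply: (@le_trans _ _ (\sum_(i < m) (L i.+1 w + K * (ind i w - ind i.+1 w)))).
  apply: ler_sum => i _; have := seg_lenS_ge t0 (S0^~ w) (Snd^~ w) i K0.
  by rewrite SS.
rewrite big_split/= -mulr_sumr lerD//.
  rewrite sum_seg_lenS lerBlDr (le_trans (_ : _ <= t)) ?ge_min ?lexx ?orbT//.
  by rewrite lerDl le_min S0.
by rewrite -[leRHS]mulr1 ler_wpM2l//; exact: telescope_ind.
Qed.

Let e := \int[P]_w Num.min (T0 w) t ^+ 2.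

Let SL0 w : L 0%N w = Num.min (T0 w) t.
Proof. by rewrite /L /seg_len /S /renewal_time big_ord0 addr0 subr0. Qed.

Let bT0 : bounded_rv (fun w => Num.min (T0 w) t).
Proof. exact: bounded_rv_min. Qed.

(* The constant 1 comes from [x <= 1 + x ^ 2] for [x = min T0 t]. *)
Lemma renewal_sum_lower m : t * (1 - u m) <= 1 + e + trunc_mean F t * U m.
Proof.
have bt := bounded_rv_cst T t.
have b1 := bounded_rv_cst T (1 : R).
have -> : t * (1 - u m) = \int[P]_w (t * (1 - ind m w)).
  rewrite RintegralZl//; last exact: (bounded_rv_integrable P (bounded_rvB b1 (bind m))).
  rewrite RintegralB//; [|exact: (bounded_rv_integrable P b1)
    |exact: (bounded_rv_integrable P (bind m))].
  by rewrite Rintegral_probability_cst.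
rewrite -wald_sum// -[X in X + e](Rintegral_probability_cst P) -RintegralD//; last 2 first.
  exact: (bounded_rv_integrable P b1).
  exact: (bounded_rv_integrable P (bounded_rvX2 bT0)).
rewrite -RintegralD//; last 2 first.
  exact: (bounded_rv_integrable P (bounded_rvD b1 (bounded_rvX2 bT0))).
  exact: (bounded_rv_integrable P (bsum1 m t0)).
apply: le_Rintegral => //.
- exact: (bounded_rv_integrable P (bounded_rvM bt (bounded_rvB b1 (bind m)))).
- exact: (bounded_rv_integrable P (bounded_rvD (bounded_rvD b1 (bounded_rvX2 bT0)) (bsum1 m t0))).
move=> w _; apply: (@le_trans _ _ (Num.min (S m w) t)).
  have := S0 m w; rewrite /ind /S; have ? := t0.
  by case: (leP (renewal_time _ _ _ _)) => /= ? ?; lra.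
rewrite -(sum_seg_len (S^~ w)) big_ord_recl/= lerD//.
  by rewrite -/(L 0%N w) SL0; set x := Num.min _ _; nra.
apply: ler_sum => i _; have := seg_lenS_le t0 (S0^~ w) (Snd^~ w) i.
by rewrite SS.
Qed.

Definition sum_sqr_len m : R := \int[P]_w \sum_(n < m.+1) L n w ^+ 2.

Let bLs m : bounded_rv (fun w => \sum_(n < m.+1) L n w ^+ 2).
Proof. by apply: bounded_rv_sum => i; exact: bounded_rvX2. Qed.

Lemma sum_sqr_len_upper m : sum_sqr_len m <= e + trunc_sqr F t * U m.
Proof.
rewrite -wald_sum_sqr// -RintegralD//; last 2 first.
  exact: (bounded_rv_integrable P (bounded_rvX2 bT0)).
  exact: (bounded_rv_integrable P (bsum m 1 t0)).
apply: le_Rintegral => //.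
- exact: (bounded_rv_integrable P (bLs m)).
- exact: (bounded_rv_integrable P (bounded_rvD (bounded_rvX2 bT0) (bsum m 1 t0))).
move=> w _; rewrite big_ord_recl/= SL0 lerD2l.
apply: ler_sum => i _; have := seg_lenS_sqr_le t0 (S0^~ w) (Snd^~ w) i.
by rewrite SS.
Qed.

Lemma sum_sqr_len_lower m K : 0 <= K -> trunc_sqr F K * U m <= sum_sqr_len m + K ^+ 2.
Proof.
move=> K0; rewrite -wald_sum_sqr// -[X in _ + X](Rintegral_probability_cst P).
have bK := bounded_rv_cst T (K ^+ 2).
rewrite -RintegralD//; last 2 first.
  exact: (bounded_rv_integrable P (bLs m)).
  exact: (bounded_rv_integrable P bK).
apply: le_Rintegral => //.
- exact: (bounded_rv_integrable P (bsum m 1 K0)).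
- exact: (bounded_rv_integrable P (bounded_rvD (bLs m) bK)).
move=> w _.
apply: (@le_trans _ _ (\sum_(i < m) (L i.+1 w ^+ 2 + K ^+ 2 * (ind i w - ind i.+1 w)))).
  apply: ler_sum => i _; have := seg_lenS_sqr_ge t0 (S0^~ w) (Snd^~ w) i K0.
  by rewrite SS.
rewrite big_split/= -mulr_sumr lerD//.
  by rewrite [leRHS]big_ord_recl/= lerDr sqr_ge0.
by rewrite -[leRHS]mulr1 ler_wpM2l ?sqr_ge0//; exact: telescope_ind.
Qed.

Let velocity_mean n j : \int[P]_w V n w j = 0.
Proof.
case: setup => _ [_ [_ [_ [_ [/(_ n j) + _]]]]].
by rewrite expectation.unlock /Rintegral => ->.
Qed.

Let v2_gt0 : 0 < v2.
Proof. by case: setup => _ [_ [_ [_ [_ [_ [_ [+ _]]]]]]]. Qed.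

Let velocity_integral n : (\int[P]_w (\sum_(j < d) V n w j ^+ 2)%:E = v2%:E)%E.
Proof.
by case: setup => _ [_ [_ [_ [_ [_ [/(_ n) + _]]]]]]; rewrite expectation.unlock.
Qed.

Let mV2 n j : measurable_fun setT (fun w => V n w j ^+ 2).
Proof. exact: measurable_funX. Qed.

Let integrable_velocity_sqr n j :
  P.-integrable setT (EFin \o (fun w => V n w j ^+ 2)).
Proof.
have mVs : measurable_fun setT (fun w => \sum_(j < d) V n w j ^+ 2).
  by apply: measurable_sum => i; exact: mV2.
apply: (@le_integrable _ _ _ P setT measurableT _
  (EFin \o (fun w => \sum_(j < d) V n w j ^+ 2))).
- exact/measurable_EFinP/mV2.
- move=> w _ /=; rewrite lee_fin !ger0_norm ?sqr_ge0//; last first.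
    by apply: sumr_ge0 => i _; exact: sqr_ge0.
  rewrite (bigD1 j)//= lerDl.
  by apply: sumr_ge0 => i _; exact: sqr_ge0.
- apply/integrableP; split; first exact/measurable_EFinP.
  rewrite (eq_integral (fun w => (\sum_(j < d) V n w j ^+ 2)%:E)).
    by rewrite velocity_integral ltry.
  move=> w _ /=; rewrite ger0_norm//.
  by apply: sumr_ge0 => i _; exact: sqr_ge0.
Qed.

Let integrable_velocity n j : P.-integrable setT (EFin \o (fun w => V n w j)).
Proof.
apply: (@le_integrable _ _ _ P setT measurableT _
  (EFin \o (fun w => 1 + V n w j ^+ 2))).
- exact/measurable_EFinP/mV.
- move=> w _ /=; rewrite lee_fin [leRHS]ger0_norm ?addr_ge0 ?sqr_ge0//.
  by move: (V n w j) => x; case: (ger0P x) => ?; nra.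
- have := integrableD measurableT (bounded_rv_integrable P (bounded_rv_cst T 1))
    (integrable_velocity_sqr n j).
  exact.
Qed.

Let integrable_velocityM n k j :
  P.-integrable setT (EFin \o (fun w => V n w j * V k w j)).
Proof.
apply: (@le_integrable _ _ _ P setT measurableT _
  (EFin \o (fun w => V n w j ^+ 2 + V k w j ^+ 2))).
- by apply/measurable_EFinP; exact: measurable_funM.
- move=> w _ /=; rewrite lee_fin [leRHS]ger0_norm ?addr_ge0 ?sqr_ge0//.
  by move: (V n w j) (V k w j) => x y; case: (ger0P (x * y)) => ?; nra.
- have := integrableD measurableT (integrable_velocity_sqr n j)
    (integrable_velocity_sqr k j).
  exact.
Qed.

Let sum_velocity_sqr n : \sum_(j < d) \int[P]_w V n w j ^+ 2 = v2.
Proof.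
by rewrite -Rintegral_sum// /Rintegral velocity_integral.
Qed.

Section before_renewal.
Variable m : nat.

Let Y n w : R := L n w * (1 - ind m w).

Let bY n : bounded_rv (Y n).
Proof.
by apply: bounded_rvM => //; apply: bounded_rvB => //; exact: bounded_rv_cst.
Qed.

Let other_Y k n : bounded_rv
  (Y n : g_sigma_algebraType (other_events (rv_events T0 tau V) (Some (inr k))) -> R).
Proof.
have mSo i : measurable_fun setT
    (S i : g_sigma_algebraType (other_events (rv_events T0 tau V) (Some (inr k))) -> R).
  exact: other_renewal_time.
apply: bounded_rvM.
  by apply: bounded_rv_seg_len => // i _; exact: mSo.
apply: bounded_rvB; first exact: bounded_rv_cst.
exact: bounded_rv_le.
Qed.

Let velocity_orthogonal n k j : n != k ->
  \int[P]_w (V n w j * V k w j * (Y n w * Y k w)) = 0.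
Proof.
move=> nk; rewrite (@eq_Rintegral _ _ _ P setT (fun w => V n w j * (Y n w * Y k w) * V k w j)).
  rewrite indep_integralM ?velocity_mean ?mulr0//.
  - apply: (mutually_independent_rv mC CT CI indC (i := Some (inr k))).
      apply: measurable_funM; last by have [] := bounded_rvM (other_Y k n) (other_Y k k).
      by apply: other_velocity; apply: contraNneq nk => -[->].
    by move=> B mB; exact: rv_events_velocity.
  - exact: (integrable_bounded_rvM (P := P) (integrable_velocity n j) (bounded_rvM (bY n) (bY k))).
  - have := integrable_bounded_rvM (P := P) (integrable_velocityM n k j)
      (bounded_rvM (bY n) (bY k)).
    by apply: eq_integrable => // w _ /=; rewrite mulrAC.
by move=> w _; rewrite mulrAC.
Qed.

Let velocity_diagonal n j :
  \int[P]_w (V n w j ^+ 2 * Y n w ^+ 2)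
    = (\int[P]_w V n w j ^+ 2) * (\int[P]_w Y n w ^+ 2).
Proof.
rewrite mulrC (@eq_Rintegral _ _ _ P setT (fun w => Y n w ^+ 2 * V n w j ^+ 2)); last first.
  by move=> w _; rewrite mulrC.
apply: indep_integralM.
- apply: (mutually_independent_rv mC CT CI indC (i := Some (inr n))).
    by have [] := bounded_rvX2 (other_Y n n).
  move=> B mB.
  have -> : (fun w => V n w j ^+ 2) @^-1` B =
            (fun w => V n w j) @^-1` ((fun x => x ^+ 2) @^-1` B) by [].
  apply: rv_events_velocity; rewrite -[X in measurable X]setTI.
  exact: measurable_funX.
- exact/bounded_rv_integrable/bounded_rvX2.
- exact: integrable_velocity_sqr.
- have := integrable_bounded_rvM (P := P) (integrable_velocity_sqr n j) (bounded_rvX2 (bY n)).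
  by apply: eq_integrable => // w _ /=; rewrite mulrC.
Qed.

(* The squared displacement on the event [t < T_m], where only the first [m + 1]
   segments matter, and 0 elsewhere (see [sqr_disp_beforeE]). *)
Definition sqr_disp_before w : R :=
  \sum_(j < d) (\sum_(n < m.+1) V n w j * (L n w * (1 - ind m w))) ^+ 2.
Let Q := sqr_disp_before.

Let QE w : Q w = \sum_(j < d) \sum_(n < m.+1) \sum_(k < m.+1)
  V n w j * V k w j * (Y n w * Y k w).
Proof.
rewrite /Q; apply: eq_bigr => j _; rewrite expr2 mulr_suml.
apply: eq_bigr => n _; rewrite mulr_sumr; apply: eq_bigr => k _.
by rewrite mulrACA.
Qed.

Let integrable_term n k j :
  P.-integrable setT (EFin \o (fun w => V n w j * V k w j * (Y n w * Y k w))).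
Proof.
exact: (integrable_bounded_rvM (P := P) (integrable_velocityM n k j)
  (bounded_rvM (bY n) (bY k))).
Qed.

Let integrable_rsum (I : finType) (f : I -> T -> R) :
  (forall i, P.-integrable setT (EFin \o f i)) ->
  P.-integrable setT (EFin \o (fun w => \sum_i f i w)).
Proof.
move=> intf; have := @integrable_sum _ _ _ P setT measurableT _ (index_enum I) xpredT
  (fun i w => (f i w)%:E) (fun i _ => intf i).
by apply: eq_integrable => // w _ /=; rewrite sumEFin.
Qed.

Lemma sqr_disp_before_integrable : P.-integrable setT (EFin \o Q).
Proof.
rewrite (_ : Q = fun w => \sum_(j < d) \sum_(n < m.+1) \sum_(k < m.+1)
  V n w j * V k w j * (Y n w * Y k w)); last by apply/funext => w; exact: QE.
apply: integrable_rsum => j; apply: integrable_rsum => n.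
by apply: integrable_rsum => k; exact: integrable_term.
Qed.

Let integral_Q : \int[P]_w Q w = v2 * \int[P]_w \sum_(n < m.+1) Y n w ^+ 2.
Proof.
rewrite (eq_Rintegral P (fun w _ => QE w)) Rintegral_sum; last first.
  move=> j; apply: integrable_rsum => n; apply: integrable_rsum => k.
  exact: integrable_term.
rewrite Rintegral_sum; last by move=> n; exact/bounded_rv_integrable/bounded_rvX2.
rewrite mulr_sumr.
under eq_bigr => j _.
  rewrite Rintegral_sum; last first.
    by move=> n; apply: integrable_rsum => k; exact: integrable_term.
  under eq_bigr => n _.
    rewrite Rintegral_sum; last by move=> k; exact: integrable_term.
    rewrite (bigD1 n)//= big1 ?addr0; last first.
      by move=> k kn; apply: velocity_orthogonal; rewrite eq_sym.
    rewrite (@eq_Rintegral _ _ _ P setT (fun w => V n w j ^+ 2 * Y n w ^+ 2))//.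
    rewrite velocity_diagonal.
  over.
over.
rewrite exchange_big/=; apply: eq_bigr => n _.
by rewrite -mulr_suml sum_velocity_sqr.
Qed.

Lemma sqr_disp_before_upper : \int[P]_w Q w <= v2 * sum_sqr_len m.
Proof.
rewrite integral_Q ler_pM2l//; apply: le_Rintegral => //.
- by apply: bounded_rv_integrable; apply: bounded_rv_sum => n; exact: bounded_rvX2.
- exact: (bounded_rv_integrable P (bLs m)).
move=> w _; apply: ler_sum => n _; rewrite /Y /ind; case: (S m w <= t)%R.
  by rewrite subrr mulr0 expr0n/= sqr_ge0.
by rewrite subr0 mulr1.
Qed.

Lemma sqr_disp_before_lower :
  v2 * (sum_sqr_len m - t ^+ 2 * u m) <= \int[P]_w Q w.
Proof.
have bt := bounded_rv_cst T (t ^+ 2).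
rewrite integral_Q ler_pM2l//.
rewrite -RintegralZl//; last exact: (bounded_rv_integrable P (bind m)).
rewrite -RintegralB//; last 2 first.
- exact: (bounded_rv_integrable P (bLs m)).
- exact: (bounded_rv_integrable P (bounded_rvM bt (bind m))).
apply: le_Rintegral => //.
- exact: (bounded_rv_integrable P (bounded_rvB (bLs m) (bounded_rvM bt (bind m)))).
- by apply: bounded_rv_integrable; apply: bounded_rv_sum => n; exact: bounded_rvX2.
move=> w _; rewrite /Y /ind -/(S m w); case: (S m w <= t)%R.
  rewrite mulr1 (le_trans (_ : _ <= 0))//.
    by rewrite subr_le0; apply: sum_seg_len_sqr.
  by apply: sumr_ge0 => n _; exact: sqr_ge0.
rewrite mulr0 subr0; apply: ler_sum => n _.
by rewrite subr0 mulr1.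
Qed.

End before_renewal.

Let S_homo w n k : (n <= k)%N -> S n w <= S k w.
Proof.
move=> nk; rewrite -(subnK nk); elim: (k - n)%N => [|i IH]; first by rewrite add0n.
by rewrite addSn (le_trans IH).
Qed.

Let sqr_disp w : R := \sum_(j < d) displacement T0 tau V t w j ^+ 2.

Let sqr_disp_ge0 w : 0 <= sqr_disp w.
Proof. by apply: sumr_ge0 => j _; exact: sqr_ge0. Qed.

Let msdE : msd P T0 tau V t = (\int[P]_w (sqr_disp w)%:E)%E.
Proof. by rewrite /msd expectation.unlock. Qed.

Let sqr_disp_beforeE m w : sqr_disp_before m w = sqr_disp w * (1 - ind m w).
Proof.
rewrite /sqr_disp_before /sqr_disp mulr_suml; apply: eq_bigr => j _.
rewrite /ind; case: (leP (S m w) t) => Smt.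
  rewrite subrr mulr0 big1 ?expr0n//= => n _.
  by rewrite !mulr0.
rewrite subr0 mulr1; congr (_ ^+ 2); rewrite /displacement.
rewrite (integral_seg_index (fun n => V n w j) t0 (S0^~ w) (S_homo w) Smt)/=.
by apply: eq_bigr => n _; rewrite mulr1.
Qed.

Lemma msd_ge_before m :
  ((\int[P]_w sqr_disp_before m w)%:E <= msd P T0 tau V t)%E.
Proof.
rewrite msdE /Rintegral fineK; last first.
  exact: (integrable_fin_num measurableT (sqr_disp_before_integrable m)).
apply: (ge0_le_integral_off_null (N := set0)) => //.
- by move=> w; rewrite lee_fin sumr_ge0// => j _; exact: sqr_ge0.
- move=> w _; rewrite lee_fin sqr_disp_beforeE ler_piMr//.
  by rewrite gerBl.
Qed.

Lemma msd_le_before (c : R) :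
  (forall eps, 0 < eps -> exists m, u m <= eps) ->
  (forall m, \int[P]_w sqr_disp_before m w <= c) ->
  (msd P T0 tau V t <= c%:E)%E.
Proof.
move=> u0 Qc; rewrite msdE.
pose g (m : nat) w : \bar R := (sqr_disp_before m w)%:E.
have g0 m w : (0 <= g m w)%E.
  by rewrite lee_fin sumr_ge0// => j _; exact: sqr_ge0.
have gnd w : {homo g^~ w : n m / (n <= m)%N >-> (n <= m)%E}.
  move=> n k nk; rewrite lee_fin !sqr_disp_beforeE ler_wpM2l// lerD2l lerN2.
  rewrite ler_nat; case: (leP (S k w) t) => // kt.
  by rewrite (le_trans (S_homo w nk) kt).
have mg m : measurable_fun setT (g m).
  exact: (measurable_int P (sqr_disp_before_integrable m)).
pose N := \bigcap_n [set w | S n w <= t].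
have mSn n : measurable [set w | S n w <= t] by exact: measurable_set_ler.
have mN : measurable N by exact: bigcapT_measurable.
have N0 : P N = 0%E.
  apply/eqP; rewrite eq_le measure_ge0 andbT.
  apply/lee_addgt0Pr => eps /u0[m um]; rewrite add0e.
  apply: (@le_trans _ _ (u m)%:E); last by rewrite lee_fin.
  rewrite -renewal_probE; apply: le_measure; rewrite ?inE//.
  by move=> w /(_ m I).
apply: (@le_trans _ _ (\int[P]_w limn (g^~ w))%E).
  apply: (ge0_le_integral_off_null _ _ mN N0).
  - by move=> w; rewrite lee_fin.
  - move=> w; apply: lime_ge; last by apply: nearW => n; exact: g0.
    exact/ereal_nondecreasing_is_cvgn/gnd.
  - move=> w Nw; have [n tSn] : exists n, t < S n w.
      apply: contrapT => H; apply: Nw => n _ /=; rewrite leNgt; apply/negP => tS.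
      by apply: H; exists n.
    apply: lime_ge; first exact/ereal_nondecreasing_is_cvgn/gnd.
    near=> m; rewrite /g lee_fin sqr_disp_beforeE /ind.
    rewrite (leNgt (S m w)) (lt_le_trans tSn) ?subr0 ?mulr1//.
    apply: S_homo; near: m; exact: nbhs_infty_ge.
rewrite monotone_convergence//.
apply: lime_le.
  apply: ereal_nondecreasing_is_cvgn => n k nk.
  by apply: ge0_le_integral => // w _; exact: gnd.
apply: nearW => m.
have := Qc m; rewrite -lee_fin /Rintegral fineK//.
exact: (integrable_fin_num measurableT (sqr_disp_before_integrable m)).
Unshelve. all: by end_near. Qed.

Let renewal_prob_le m i : (i <= m)%N -> u m <= u i.
Proof.
move=> im; rewrite -(subnK im); elim: (m - i)%N => [|k IH]; first by rewrite add0n.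
by rewrite addSn (le_trans _ IH)// renewal_prob_nonincr.
Qed.

Lemma renewal_prob_small K : 0 <= K -> 0 < trunc_mean F K ->
  forall eps, 0 < eps -> exists m, u m <= eps.
Proof.
move=> K0 mK0 eps e0; pose c := (t + K) / trunc_mean F K / eps.
exists (Num.truncn c).+1; set m := _.+1.
have cm : c < m%:R by exact: truncnS_gt.
have mu : m%:R * u m <= U m.
  rewrite /U /renewal_sum mulr_natl -[X in _ *+ X]card_ord -sumr_const.
  by apply: ler_sum => i _; apply: renewal_prob_le; exact/ltnW.
have := renewal_sum_upper m K0; rewrite mulrC -ler_pdivlMr// => Ub.
have m0 : 0 < m%:R :> R by rewrite ltr0n.
rewrite -(ler_pM2l m0) (le_trans mu)// (le_trans Ub)//.
by rewrite -ler_pdivrMr// ltW.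
Qed.

Lemma trunc_sqr_ge0 K : 0 <= K -> 0 <= trunc_sqr F K.
Proof.
move=> K0; rewrite -(expectation_sqr_min (mtau 0%N) (tau_ge0 0%N) (tauF 0%N) K0).
by apply: Rintegral_ge0 => w _; exact: sqr_ge0.
Qed.

Lemma msd_upper K : 0 <= K -> 0 < trunc_mean F K ->
  (msd P T0 tau V t <=
   (v2 * (e + trunc_sqr F t * ((t + K) / trunc_mean F K)))%:E)%E.
Proof.
move=> K0 mK0; apply: msd_le_before; first exact: (renewal_prob_small K0 mK0).
move=> m; rewrite (le_trans (sqr_disp_before_upper m))// ler_pM2l//.
rewrite (le_trans (sum_sqr_len_upper m))// lerD2l ler_wpM2l ?trunc_sqr_ge0//.
by rewrite ler_pdivlMr// mulrC renewal_sum_upper.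
Qed.

Lemma msd_lower K : 0 <= K -> 0 < trunc_mean F t ->
  ((v2 * (trunc_sqr F K * ((t - 1 - e) / trunc_mean F t) - K ^+ 2))%:E
   <= msd P T0 tau V t)%E.
Proof.
move=> K0 mt0.
have lb m : ((v2 * (trunc_sqr F K * ((t * (1 - u m) - 1 - e) / trunc_mean F t)
    - K ^+ 2 - t ^+ 2 * u m))%:E <= msd P T0 tau V t)%E.
  apply: le_trans (msd_ge_before m); rewrite lee_fin.
  rewrite (le_trans _ (sqr_disp_before_lower m))// ler_pM2l// lerD2r lerBlDr.
  rewrite (le_trans _ (sum_sqr_len_lower m K0))// ler_wpM2l ?trunc_sqr_ge0//.
  rewrite ler_pdivrMr// mulrC; have := renewal_sum_lower m.
  by rewrite -/U; lra.
have : (0 <= msd P T0 tau V t)%E by rewrite msdE; apply: integral_ge0 => w _; rewrite lee_fin.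
case: (msd P T0 tau V t) lb => [r||] lb // _; last by rewrite leey.
rewrite lee_fin leNgt; apply/negP => rlt.
set A := v2 * _ in rlt.
pose B := v2 * (trunc_sqr F K * t / trunc_mean F t + t ^+ 2).
have B0 : 0 <= B.
  by rewrite mulr_ge0 ?(ltW v2_gt0)// addr_ge0 ?sqr_ge0// divr_ge0 ?mulr_ge0 ?trunc_sqr_ge0// ltW.
have e0 : 0 < (A - r) / (2 * (B + 1)) by rewrite divr_gt0; lra.
have [m um] := renewal_prob_small t0 mt0 e0.
have := lb m; rewrite lee_fin => {}lb.
have H : v2 * (trunc_sqr F K * ((t * (1 - u m) - 1 - e) / trunc_mean F t)
    - K ^+ 2 - t ^+ 2 * u m) = A - B * u m by rewrite /A /B; ring.
rewrite H in lb.
have u0 := renewal_prob_ge0 m; rewrite -/u in u0.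
have um' : u m * (2 * (B + 1)) <= A - r.
  by rewrite -ler_pdivlMr//; lra.
nra.
Qed.

End renewal_process.

Section interarrival_moments.
Context (R : realType).
Notation mu := (@lebesgue_measure R).
Variable F : R -> R.
Hypotheses (cF : continuous F) (F_at0 : F 0 = 0) (F_le1 : forall s, F s <= 1).
Hypotheses (taubar_fin : (taubar F < +oo)%E) (sigma2_fin : (sigma2 F < +oo)%E).

Let mF : measurable_fun setT F. Proof. exact: continuous_measurable_fun. Qed.

Let mh1 : measurable_fun setT (fun s => 1 - F s).
Proof. exact: measurable_funB. Qed.

Let mh2 : measurable_fun setT (fun s : R => 2 * s * (1 - F s)).
Proof. by apply: measurable_funM => //; exact: measurable_funM. Qed.

Let h1_ge0 (s : R) : 0 <= 1 - F s. Proof. by rewrite subr_ge0. Qed.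

Let h2_ge0 (s : R) : 0 <= s -> 0 <= 2 * s * (1 - F s).
Proof. by move=> s0; rewrite !mulr_ge0. Qed.

Let in0y (s : R) : `[0, +oo[%classic s -> 0 <= s.
Proof. by rewrite /= in_itv/= andbT. Qed.

Let taubarE : (fine (taubar F))%:E = taubar F.
Proof.
by rewrite fineK// ge0_fin_numE//; apply: integral_ge0 => s _; rewrite lee_fin.
Qed.

Let sigma2E : (fine (sigma2 F))%:E = sigma2 F.
Proof.
rewrite fineK// ge0_fin_numE//; apply: integral_ge0 => s /in0y s0.
by rewrite lee_fin h2_ge0.
Qed.

Let integrable_h1 : mu.-integrable `[0, +oo[ (EFin \o (fun s => 1 - F s)).
Proof.
apply/integrableP; split.
  by apply/measurable_EFinP; exact: measurable_funTS.
apply: le_lt_trans taubar_fin; rewrite le_eqVlt; apply/orP; left; apply/eqP.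
by apply: eq_integral => s _ /=; rewrite ger0_norm.
Qed.

Let integrable_h2 : mu.-integrable `[0, +oo[ (EFin \o (fun s : R => 2 * s * (1 - F s))).
Proof.
apply/integrableP; split.
  by apply/measurable_EFinP; exact: measurable_funTS.
apply: le_lt_trans sigma2_fin; rewrite le_eqVlt; apply/orP; left; apply/eqP.
by apply: eq_integral => s; rewrite inE => /in0y s0 /=; rewrite ger0_norm// h2_ge0.
Qed.

Let taubarB K : 0 <= K -> fine (taubar F) - trunc_mean F K =
  \int[mu]_(s in `]K, +oo[) (1 - F s).
Proof. by move=> K0; rewrite -(Rintegral_itvB integrable_h1)// bnd_simp. Qed.

Let sigma2B K : 0 <= K -> fine (sigma2 F) - trunc_sqr F K =
  \int[mu]_(s in `]K, +oo[) (2 * s * (1 - F s)).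
Proof. by move=> K0; rewrite -(Rintegral_itvB integrable_h2)// bnd_simp. Qed.

Lemma trunc_mean_le_taubar K : 0 <= K -> trunc_mean F K <= fine (taubar F).
Proof. by move=> K0; rewrite -subr_ge0 taubarB// Rintegral_ge0. Qed.

Lemma trunc_sqr_le_sigma2 K : 0 <= K -> trunc_sqr F K <= fine (sigma2 F).
Proof.
move=> K0; rewrite -subr_ge0 sigma2B// Rintegral_ge0// => s /=.
by rewrite in_itv/= andbT => Ks; rewrite h2_ge0// (le_trans K0)// ltW.
Qed.

Let Rintegral_itv_homo (h : R -> R) K L : measurable_fun setT h ->
  (forall s, 0 <= s -> 0 <= h s) -> mu.-integrable `[0, +oo[ (EFin \o h) ->
  K <= L -> \int[mu]_(s in `[0, K]) h s <= \int[mu]_(s in `[0, L]) h s.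
Proof.
move=> mh h0 ih KL.
have fin a : (\int[mu]_(s in `[0%R, a]) (h s)%:E)%E \is a fin_num.
  apply: integrable_fin_num => //; apply: integrableS ih => //= u /=.
  by rewrite !in_itv/= !andbT; case/andP.
apply: fine_le; [exact: fin|exact: fin|apply: ge0_subset_integral => //=].
- by apply/measurable_EFinP; exact: measurable_funTS.
- by move=> u; rewrite in_itv/= => /andP[u0 _]; rewrite lee_fin h0.
- by move=> u /=; rewrite !in_itv/= => /andP[-> uK]; exact: le_trans KL.
Qed.

Lemma trunc_mean_homo K L : K <= L -> trunc_mean F K <= trunc_mean F L.
Proof. exact: Rintegral_itv_homo. Qed.

Lemma trunc_sqr_homo K L : K <= L -> trunc_sqr F K <= trunc_sqr F L.
Proof. exact: Rintegral_itv_homo. Qed.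

Lemma trunc_mean_approx e : 0 < e ->
  exists K, 0 < K /\ fine (taubar F) - e <= trunc_mean F K.
Proof. by apply: ge0_integral_itvcy_approx. Qed.

Lemma trunc_sqr_approx e : 0 < e ->
  exists K, 0 < K /\ fine (sigma2 F) - e <= trunc_sqr F K.
Proof. by apply: ge0_integral_itvcy_approx. Qed.

Let F_near0 : exists2 a, 0 < a & forall s, 0 <= s <= a -> 1/2 <= 1 - F s.
Proof.
have /cvgrPdist_le /(_ (1/2)) [|a /= a0 Ha] := @cF 0; first by lra.
exists (a / 2) => [|s /andP[s0 sa]]; first by rewrite divr_gt0.
have /Ha : `|0 - s| < a by rewrite sub0r normrN ger0_norm//; lra.
by rewrite F_at0 sub0r normrN => /ler_normlP[]; lra.
Qed.

Lemma taubar_gt0 : 0 < fine (taubar F).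
Proof.
have [a a0 Fa] := F_near0.
rewrite -lte_fin taubarE; apply: (@lt_le_trans _ _ (\int[mu]_(s in `[0%R, a]) (1/2)%:E)%E).
  rewrite integral_cst//= lebesgue_measure_itv/= lte_fin a0 sube0 -EFinM lte_fin.
  by rewrite mulr_gt0.
apply: (@le_trans _ _ (\int[mu]_(s in `[0%R, a]) (1 - F s)%:E)%E).
  apply: ge0_le_integral => //=.
  by apply/measurable_EFinP; exact: measurable_funTS.
apply: ge0_subset_integral => //=.
- by apply/measurable_EFinP; exact: measurable_funTS.
- by move=> s _; rewrite lee_fin.
- by move=> s /=; rewrite !in_itv/= => /andP[->].
Qed.

Lemma sigma2_gt0 : 0 < fine (sigma2 F).
Proof.
have [a a0 Fa] := F_near0.
rewrite -lte_fin sigma2E.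
apply: (@lt_le_trans _ _ (\int[mu]_(s in `[0%R, a]) ((1/2)%:E * (2 * s)%:E))%E).
  rewrite ge0_integralZl//=.
  - by rewrite integral_itv_2x ?ltW// -EFinM lte_fin mulr_gt0// exprn_gt0.
  - by apply/measurable_EFinP; exact: measurable_funM.
  - by move=> s; rewrite in_itv/= => /andP[s0 _]; rewrite lee_fin mulr_ge0.
apply: (@le_trans _ _ (\int[mu]_(s in `[0%R, a]) (2 * s * (1 - F s))%:E)%E).
  apply: ge0_le_integral => //=.
  - move=> s; rewrite in_itv/= => /andP[s0 _]; rewrite -EFinM lee_fin.
    by rewrite !mulr_ge0//; lra.
  - apply/measurable_EFinP; apply: measurable_funM => //; exact: measurable_funM.
  - by apply/measurable_EFinP; exact: measurable_funTS.
  - move=> s; rewrite in_itv/= => /[dup] /Fa H /andP[s0 _]; rewrite -EFinM lee_fin.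
    by rewrite mulrC ler_wpM2l// mulr_ge0.
apply: ge0_subset_integral => //=.
- by apply/measurable_EFinP; exact: measurable_funTS.
- by move=> s /in0y s0; rewrite lee_fin h2_ge0.
- by move=> s /=; rewrite !in_itv/= => /andP[->].
Qed.

(* [s (taubar - trunc_mean s) = s int_s^oo (1 - F) <= int_s^oo u (1 - F u) du] *)
Lemma equilibrium_tail s : 0 <= s ->
  2 * s * (1 - F0 F s) <= (fine (sigma2 F) - trunc_sqr F s) / fine (taubar F).
Proof.
move=> s0; have tau0 := taubar_gt0.
have -> : F0 F s = trunc_mean F s / fine (taubar F) by [].
rewrite ler_pdivlMr// mulrBr mulr1 mulrBl -[X in _ - X]mulrA divfK ?gt_eqF//.
rewrite -mulrBr taubarB// sigma2B// -RintegralZl//; last first.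
  apply: integrableS integrable_h1 => //= u /=; rewrite !in_itv/= !andbT.
  by move=> /ltW; exact: le_trans.
apply: le_Rintegral => //.
- have := @integrableZl _ _ _ mu `]s, +oo[%classic (measurable_itv _) (2 * s)
    (EFin \o (fun s => 1 - F s)).
  apply; apply: integrableS integrable_h1 => //= u /=; rewrite !in_itv/= !andbT.
  by move=> /ltW; exact: le_trans.
- apply: integrableS integrable_h2 => //= u /=; rewrite !in_itv/= !andbT.
  by move=> /ltW; exact: le_trans.
- move=> u /=; rewrite in_itv/= andbT => su; rewrite ler_wpM2r//.
  by rewrite ler_pM2l// ltW.
Qed.

Lemma equilibrium_trunc_sqr_small eps : 0 < eps -> exists A, forall t, A <= t ->
  trunc_sqr (F0 F) t <= eps * t.
Proof.
move=> eps0; have tau0 := taubar_gt0; have sig0 := sigma2_gt0.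
set a := fine (taubar F) in tau0 *; set b := fine (sigma2 F) in sig0 *.
have e0 : 0 < eps / 2 * a by rewrite mulr_gt0// divr_gt0.
have [K [K0 HK]] := trunc_sqr_approx e0; rewrite -/b in HK.
pose c := b / a; have c0 : 0 < c by rewrite divr_gt0.
exists (2 * (c * K) / eps) => t At.
have [cw Kw ew] : [/\ 0 <= c, 0 <= K & 0 <= eps] by split; exact: ltW.
have cK0 : 0 <= 2 * (c * K) / eps by rewrite divr_ge0// mulr_ge0// mulr_ge0.
have t0 : 0 <= t by exact: le_trans At.
pose g s : R := c * \1_(`[0%R, K]%classic) s + eps / 2.
have hg s : 0 <= s -> 2 * s * (1 - F0 F s) <= g s.
  move=> s0; apply: (le_trans (equilibrium_tail s0)); rewrite -/a -/b /g.
  have [sK|Ks] := leP s K.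
    rewrite indicE mem_set/= ?in_itv/= ?s0// mulr1.
    apply: (@le_trans _ _ c); last by rewrite lerDl divr_ge0// ltW.
    rewrite /c ler_pM2r ?invr_gt0// gerBl.
    by rewrite Rintegral_ge0// => u /=; rewrite in_itv/= => /andP[u0 _]; exact: h2_ge0.
  rewrite indicE memNset/=; last by rewrite in_itv/= s0/= leNgt Ks.
  rewrite mulr0 add0r ler_pdivrMr//.
  have := trunc_sqr_homo (ltW Ks); lra.
have m1 : measurable_fun setT (\1_(`[0%R, K]%classic) : R -> R).
  exact: measurable_indic.
have mg : measurable_fun setT g.
  by apply: measurable_funD => //; exact: measurable_funM.
have g_ge0 s : 0 <= g s.
  by rewrite addr_ge0 ?divr_ge0 ?(ltW eps0)// mulr_ge0 ?(ltW c0)// indicE.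
have F0_le1 s : 0 <= s -> F0 F s <= 1.
  move=> s0; rewrite /F0 ler_pdivrMr// mul1r.
  exact: trunc_mean_le_taubar.
have ig : (\int[mu]_(s in `[0%R, t]) (g s)%:E <= (c * K + eps / 2 * t)%:E)%E.
  rewrite /g; under eq_integral do rewrite EFinD.
  rewrite ge0_integralD//=; last 3 first.
  - by move=> s _; rewrite lee_fin mulr_ge0 ?(ltW c0)// indicE.
  - by apply/measurable_EFinP; apply: measurable_funTS; exact: measurable_funM.
  - by move=> s _; rewrite lee_fin divr_ge0.
  rewrite EFinD leeD//.
    under eq_integral do rewrite EFinM.
    rewrite ge0_integralZl//=; last first.
      by apply/measurable_EFinP; exact: measurable_funTS.
    rewrite integral_indic//= [leRHS]EFinM; apply: lee_wpmul2l; first by rewrite lee_fin.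
    apply: (@le_trans _ _ (mu `[0%R, K]%classic)).
      by apply: le_measure; rewrite ?inE//=; exact: measurableI.
    by rewrite lebesgue_measure_itv/= lte_fin K0 sube0.
  rewrite integral_cst//= lebesgue_measure_itv/= lte_fin.
  case: ifPn => _; last by rewrite mule0 lee_fin mulr_ge0// divr_ge0// ltW.
  by rewrite sube0 -EFinM.
have le1 : (\int[mu]_(s in `[0%R, t]) (2 * s * (1 - F0 F s))%:E <= (c * K + eps / 2 * t)%:E)%E.
  apply: le_trans ig; rewrite integral_mkcond [leRHS]integral_mkcond.
  apply: (ge0_le_integral_off_null (N := set0)) => //.
  - move=> s; apply: erestrict_ge0 => u /=; rewrite in_itv/= => /andP[u0 _].
    by rewrite lee_fin !mulr_ge0// subr_ge0 F0_le1.
  - by move=> s; apply: erestrict_ge0 => u /=; rewrite lee_fin.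
  - move=> s _; rewrite !patchE; case: ifPn => //.
    by rewrite inE/= in_itv/= => /andP[s0 _]; rewrite lee_fin hg.
have ge0 : (0 <= \int[mu]_(s in `[0%R, t]) (2 * s * (1 - F0 F s))%:E)%E.
  apply: integral_ge0 => u /=; rewrite in_itv/= => /andP[u0 _].
  by rewrite lee_fin !mulr_ge0// subr_ge0 F0_le1.
rewrite /trunc_sqr /Rintegral.
apply: (@le_trans _ _ (c * K + eps / 2 * t)).
  by rewrite -lee_fin fineK// ge0_fin_numE// (le_lt_trans le1)// ltry.
by rewrite ler_pdivrMr// in At; lra.
Qed.

End interarrival_moments.

Section clipping.
Context (dT : measure_display) (T : measurableType dT) (R : realType)
  (P : probability T R) (d : nat).
Variables (F : R -> R) (T0 : T -> R) (tau : nat -> T -> R)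
  (V : nat -> T -> 'I_d -> R) (v2 : R).

(* The model only makes the times nonnegative almost surely; clipping makes them
   so everywhere without changing laws, independence or mean square displacement. *)
Definition clip (X : T -> R) (w : T) : R := Num.max (X w) 0.

Lemma clip_ge0 X w : 0 <= clip X w.
Proof. by rewrite /clip le_max lexx orbT. Qed.

Lemma measure_lt0_eq0 (X : T -> R) : measurable_fun setT X ->
  P [set w | X w <= 0] = 0%E -> P [set w | X w < 0] = 0%E.
Proof.
move=> mX X0; apply/eqP; rewrite eq_le measure_ge0 andbT -[leRHS]X0.
apply: le_measure; rewrite ?inE.
- exact: measurable_set_ltr.
- exact: measurable_set_ler.
- by move=> w /= /ltW.
Qed.

Lemma clip_cdf (X : T -> R) (G : R -> R) : measurable_fun setT X -> G 0 = 0 ->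
  (forall s, P [set w | X w <= s] = (G s)%:E) ->
  forall s, P [set w | clip X w <= s] = (G s)%:E.
Proof.
move=> mX G0 XG s; have [s0|s0] := leP 0 s.
  rewrite -XG; congr (P _); apply/seteqP; split=> w /=; rewrite /clip ge_max.
    by case/andP.
  by move=> ->.
have -> : [set w | clip X w <= s] = set0.
  apply/seteqP; split=> w //=; rewrite /clip ge_max => /andP[_].
  by rewrite leNgt s0.
have mle r : measurable [set w | X w <= r] by exact: measurable_set_ler.
rewrite measure0; apply/eqP; rewrite eq_sym -XG eq_le measure_ge0 andbT.
rewrite -[leRHS]/(0%:E) -G0 -XG; apply: le_measure; rewrite ?inE//.
by move=> w /= /le_trans; apply; exact: ltW.
Qed.

Lemma renewal_setup_clip : F 0 = 0 -> renewal_setup P F T0 tau V v2 ->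
  renewal_setup P F (clip T0) (fun n => clip (tau n)) V v2.
Proof.
move=> F0 [mT0 [mtau [mV [tauF [VV [EV [EV2 [v20 ind]]]]]]]].
have mclip X : measurable_fun setT X -> measurable_fun setT (clip X).
  by move=> mX; exact: measurable_maxr.
split; first exact: mclip.
split; first by move=> n; exact: mclip.
split; first by [].
split; first by move=> n; apply: clip_cdf.
do 4 (split; first by []).
have clipE X E : events_of_R (clip X) E -> events_of_R X E.
  move=> [B [mB ->]]; exists ((fun x : R => Num.max x 0) @^-1` B); split => //.
  by rewrite -[X in measurable X]setTI; exact: measurable_maxr.
move=> s E us CE; apply: ind => // i /CE.
by case: i => [[n|n]|] //=; exact: clipE.
Qed.

Lemma msd_clip t : measurable_fun setT T0 ->
  (forall n, measurable_fun setT (tau n)) ->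
  P [set w | T0 w < 0] = 0%E -> (forall n, P [set w | tau n w < 0] = 0%E) ->
  msd P T0 tau V t = msd P (clip T0) (fun n => clip (tau n)) V t.
Proof.
move=> mT0 mtau T00 tau0.
have mlt (X : T -> R) : measurable_fun setT X -> measurable [set w | X w < 0].
  by move=> mX; exact: measurable_set_ltr.
have mU : measurable (\bigcup_n [set w | tau n w < 0]).
  by apply: bigcupT_measurable => n; exact: mlt.
pose N := [set w | T0 w < 0] `|` \bigcup_n [set w | tau n w < 0].
have mN : measurable N by apply: measurableU => //; exact: mlt.
have N0 : P N = 0%E.
  apply: measure_negligible => //; apply: negligibleU.
    by exists [set w | T0 w < 0]; split => //; exact: mlt.
  apply: negligible_bigcup => n; exists [set w | tau n w < 0].
  by split; [exact: mlt|exact: tau0|].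
rewrite /msd expectation.unlock; apply: (ge0_eq_integral_off_null _ _ mN N0).
- by move=> w; rewrite lee_fin sumr_ge0// => j _; exact: sqr_ge0.
- by move=> w; rewrite lee_fin sumr_ge0// => j _; exact: sqr_ge0.
move=> w Nw; have T0E : T0 w = clip T0 w.
  rewrite /clip max_l// leNgt; apply/negP => T0w.
  by apply: Nw; left.
have tauE n : tau n w = clip (tau n) w.
  rewrite /clip max_l// leNgt; apply/negP => tauw.
  by apply: Nw; right; exists n.
congr EFin; apply: eq_bigr => j _; congr (_ ^+ 2); congr fine.
apply: eq_integral => s _; rewrite /velocity.
suff -> : (fun n => renewal_time T0 tau n w) =
    (fun n => renewal_time (clip T0) (fun n => clip (tau n)) n w) by [].
apply/funext => n; rewrite /renewal_time T0E; congr (_ + _).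
by apply: eq_bigr => k _.
Qed.

End clipping.

Section asymptotics.
Context (R : realType).

Lemma linear_asymptotics (a b v : R) (m1 m2 e M : R -> R) :
  0 < a -> 0 < b -> 0 < v ->
  (forall K, 0 <= K -> m1 K <= a) -> (forall K, 0 <= K -> m2 K <= b) ->
  (forall K, 0 <= K -> 0 <= m2 K) ->
  (forall eps, 0 < eps -> exists K, 0 < K /\ a - eps <= m1 K) ->
  (forall eps, 0 < eps -> exists K, 0 < K /\ b - eps <= m2 K) ->
  (forall eps, 0 < eps -> exists A, forall t, A <= t -> e t <= eps * t) ->
  (forall K L, K <= L -> m1 K <= m1 L) ->
  (forall t K, 0 <= t -> 0 <= K -> 0 < m1 K ->
    M t <= v * (e t + m2 t * ((t + K) / m1 K))) ->
  (forall t K, 0 <= t -> 0 <= K -> 0 < m1 t ->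
    v * (m2 K * ((t - 1 - e t) / m1 t) - K ^+ 2) <= M t) ->
  forall eps, 0 < eps -> exists A, forall t, A <= t ->
    `|M t - b * v * t / a| <= eps * `|b * v * t / a|.
Proof.
move=> a0 b0 v0 m1a m2b m2_ge0 m1ap m2ap esmall m1nd Mu Ml eps eps0.
pose q := a / b; have q0 : 0 < q by rewrite divr_gt0.
pose dl := Num.min (1 / 2) (eps / (q + 3)).
have q3 : 0 < q + 3 by lra.
have dl0 : 0 < dl by rewrite lt_min divr_gt0//= divr_gt0.
have dlh : dl <= 1 / 2 by rewrite /dl ge_min lexx.
have dle : dl * (q + 3) <= eps by rewrite -ler_pdivlMr// /dl ge_min lexx orbT.
have dl2 : dl * dl <= dl / 2 by rewrite ler_pM2l//; lra.
have dl2_ge0 : 0 <= dl * dl by rewrite mulr_ge0// ltW.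
have [K1 [K10 HK1]] : exists K, 0 < K /\ a / (1 + dl) <= m1 K.
  have [|K [K0 HK]] := m1ap (a - a / (1 + dl)).
    rewrite subr_gt0 ltr_pdivrMr; last by lra.
    by rewrite mulrDr mulr1 ltrDl mulr_gt0.
  by exists K; split => //; move: HK; rewrite opprB addrCA subrr addr0.
have [K2 [K20 HK2]] : exists K, 0 < K /\ b * (1 - dl) <= m2 K.
  have [|K [K0 HK]] := m2ap (b * dl); first by rewrite mulr_gt0.
  by exists K; split => //; move: HK; lra.
have [A HA] := esmall _ dl0.
exists (Num.max A (Num.max (K1 / dl) (Num.max (1 / dl) (Num.max (K2 ^+ 2 / dl) K1)))).
move=> t; rewrite !ge_max !ler_pdivrMr// => /andP[At /andP[K1t /andP[t1 /andP[K2t Kt]]]].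
have t0 : 0 < t by exact: lt_le_trans Kt.
have et := HA _ At.
pose B := b * v * t / a.
have B0 : 0 < B by rewrite divr_gt0// !mulr_gt0.
have vqt : v * t = q * B by rewrite /q /B; field; rewrite !gt_eqF.
have m1K0 : 0 < m1 K1 by apply: lt_le_trans HK1; rewrite divr_gt0//; lra.
rewrite -/B (gtr0_norm B0) ler_norml; apply/andP; split.
- have m1t : 0 < m1 t by apply: lt_le_trans m1K0 _; exact: m1nd.
  have H := Ml t K2 (ltW t0) (ltW K20) m1t.
  suff : B * (1 - eps) <= v * (m2 K2 * ((t - 1 - e t) / m1 t) - K2 ^+ 2) by lra.
  have X1 : (1 - 2 * dl) * t / a <= (t - 1 - e t) / m1 t.
    have n0 : 0 <= (1 - 2 * dl) * t by apply: mulr_ge0; lra.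
    apply: (@le_trans _ _ ((1 - 2 * dl) * t / m1 t)).
      by rewrite ler_wpM2l// lef_pV2 ?posrE// m1a// ltW.
    by rewrite ler_pM2r ?invr_gt0//; lra.
  have X0 : 0 <= (1 - 2 * dl) * t / a.
    by rewrite divr_ge0 ?(ltW a0)//; apply: mulr_ge0; lra.
  have X2 : b * (1 - dl) * ((1 - 2 * dl) * t / a) <= m2 K2 * ((t - 1 - e t) / m1 t).
    have bd0 : 0 <= b * (1 - dl) by apply: mulr_ge0; lra.
    exact: ler_pM.
  have X3 : v * (b * (1 - dl) * ((1 - 2 * dl) * t / a) - dl * t)
      <= v * (m2 K2 * ((t - 1 - e t) / m1 t) - K2 ^+ 2).
    by rewrite ler_pM2l// lerB//; lra.
  apply: le_trans X3.
  have -> : v * (b * (1 - dl) * ((1 - 2 * dl) * t / a) - dl * t) =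
    B * ((1 - dl) * (1 - 2 * dl)) - dl * (v * t) by rewrite /B; ring.
  have -> : B * ((1 - dl) * (1 - 2 * dl)) - dl * (v * t) =
    B * ((1 - dl) * (1 - 2 * dl) - dl * q) by rewrite vqt; ring.
  by rewrite ler_pM2l//; lra.
- have H := Mu t K1 (ltW t0) (ltW K10) m1K0.
  suff : v * (e t + m2 t * ((t + K1) / m1 K1)) <= B * (1 + eps) by lra.
  have X1 : (t + K1) / m1 K1 <= (1 + dl) * t * ((1 + dl) / a).
    apply: ler_pM; rewrite ?invr_ge0 ?(ltW m1K0)//; [by lra|by lra|].
    by rewrite -[leRHS]invf_div lef_pV2 ?posrE// divr_gt0//; lra.
  have X2 : m2 t * ((t + K1) / m1 K1) <= b * ((1 + dl) * t * ((1 + dl) / a)).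
    apply: ler_pM => //; [exact/m2_ge0/ltW| |exact/m2b/ltW].
    by rewrite divr_ge0 ?(ltW m1K0)//; lra.
  have X3 : v * (e t + m2 t * ((t + K1) / m1 K1)) <=
      v * (dl * t + b * ((1 + dl) * t * ((1 + dl) / a))).
    by rewrite ler_pM2l// lerD.
  apply: (le_trans X3).
  have -> : v * (dl * t + b * ((1 + dl) * t * ((1 + dl) / a))) =
    dl * (v * t) + B * ((1 + dl) * (1 + dl)) by rewrite /B; ring.
  have -> : dl * (v * t) + B * ((1 + dl) * (1 + dl)) =
    B * (dl * q + (1 + dl) * (1 + dl)) by rewrite vqt; ring.
  by rewrite ler_pM2l//; lra.
Qed.

End asymptotics.

Section msd_asymptotics.
Context (dT : measure_display) (T : measurableType dT) (R : realType)
  (P : probability T R) (d : nat).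
Variables (F : R -> R) (T0 : T -> R) (tau : nat -> T -> R)
  (V : nat -> T -> 'I_d -> R) (v2 : R).
Hypotheses (cF : continuous F) (F_at0 : F 0 = 0).
Hypotheses (taubar_fin : (taubar F < +oo)%E) (sigma2_fin : (sigma2 F < +oo)%E).
Hypothesis setup : renewal_setup P F T0 tau V v2.

Lemma renewal_setup_cdf_le1 s : F s <= 1.
Proof.
case: setup => _ [mtau [_ [tauF _]]]; rewrite -lee_fin -(tauF 0%N).
by apply: probability_le1; exact: measurable_set_ler.
Qed.

Let F_le1 := renewal_setup_cdf_le1.

Lemma msd_equiv_nonneg : (forall w, 0 <= T0 w) -> (forall n w, 0 <= tau n w) ->
  (forall eps, 0 < eps -> exists A, forall t, A <= t ->
    \int[P]_w Num.min (T0 w) t ^+ 2 <= eps * t) ->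
  (fun t => fine (msd P T0 tau V t)) ~_(pinfty_filter R)
  (fun t => fine (sigma2 F) * v2 * t / fine (taubar F)).
Proof.
move=> T0_ge0 tau_ge0 T0small; have tau0 := taubar_gt0 cF F_at0 F_le1 taubar_fin.
have sig0 := sigma2_gt0 cF F_at0 F_le1 sigma2_fin.
have v20 : 0 < v2 by case: setup => _ [_ [_ [_ [_ [_ [_ [+ _]]]]]]].
have [K0 [K0_gt0 mK0]] : exists K, 0 < K /\ 0 < trunc_mean F K.
  have [|K [K0 HK]] := trunc_mean_approx cF F_le1 taubar_fin (e := fine (taubar F) / 2).
    by rewrite divr_gt0.
  by exists K; split => //; lra.
have msdE t : 0 <= t -> (fine (msd P T0 tau V t))%:E = msd P T0 tau V t.
  move=> t0; rewrite fineK// ge0_fin_numE.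
    by apply: le_lt_trans (msd_upper setup T0_ge0 tau_ge0 t0 (ltW K0_gt0) mK0) _; rewrite ltry.
  rewrite /msd; apply: expectation_ge0 => w.
  by apply: sumr_ge0 => j _; exact: sqr_ge0.
apply/eqaddoP => eps eps0.
have [A HA] := @linear_asymptotics R _ _ _ (trunc_mean F) (trunc_sqr F)
  (fun t => \int[P]_w Num.min (T0 w) t ^+ 2) (fun t => fine (msd P T0 tau V t))
  tau0 sig0 v20 (trunc_mean_le_taubar cF F_le1 taubar_fin)
  (trunc_sqr_le_sigma2 cF F_le1 sigma2_fin) (trunc_sqr_ge0 setup tau_ge0)
  (trunc_mean_approx cF F_le1 taubar_fin) (trunc_sqr_approx cF F_le1 sigma2_fin)
  T0small (trunc_mean_homo cF F_le1 taubar_fin)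
  (fun t K t0 K0 mK => ltac:(rewrite -lee_fin msdE//; exact: msd_upper))
  (fun t K t0 K0 mt => ltac:(rewrite -lee_fin msdE//; exact: msd_lower)) eps eps0.
by exists A; split => [|t /ltW At]; [exact: num_real|exact: HA].
Qed.

End msd_asymptotics.

Section msd_equiv.
Context (dT : measure_display) (T : measurableType dT) (R : realType)
  (P : probability T R) (d : nat).
Variables (F : R -> R) (T0 : T -> R) (tau : nat -> T -> R)
  (V : nat -> T -> 'I_d -> R) (v2 : R).
Hypotheses (cF : continuous F) (F_at0 : F 0 = 0).
Hypotheses (taubar_fin : (taubar F < +oo)%E) (sigma2_fin : (sigma2 F < +oo)%E).
Hypothesis setup : renewal_setup P F T0 tau V v2.

Lemma msd_equiv : P [set w | T0 w < 0] = 0%E ->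
  (forall eps, 0 < eps -> exists A, forall t, A <= t ->
    \int[P]_w Num.min (clip T0 w) t ^+ 2 <= eps * t) ->
  (fun t => fine (msd P T0 tau V t)) ~_(pinfty_filter R)
  (fun t => fine (sigma2 F) * v2 * t / fine (taubar F)).
Proof.
move=> T0neg T0small; have [mT0 [mtau [_ [tauF _]]]] := setup.
rewrite (_ : (fun t => fine (msd P T0 tau V t)) =
    fun t => fine (msd P (clip T0) (fun n => clip (tau n)) V t)).
  apply: msd_equiv_nonneg => //; first exact: renewal_setup_clip.
  - by move=> w; exact: clip_ge0.
  - by move=> n w; exact: clip_ge0.
apply/funext => t; rewrite (msd_clip _ _ mT0 mtau T0neg)// => n.
by apply: measure_lt0_eq0 => //; rewrite tauF F_at0.
Qed.

End msd_equiv.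

Unset Implicit Arguments.

Theorem theorem8p2 (R : realType) (F : R -> R) (d : nat) (v2 : R) :
  continuous F -> F 0 = 0 ->
  (taubar F < +oo)%E -> (sigma2 F < +oo)%E ->
  (* transitional case: T0 = 0 *)
  (forall (dT : measure_display) (T : measurableType dT) (P : probability T R)
          (tau : nat -> T -> R) (V : nat -> T -> 'I_d -> R),
      renewal_setup P F (fun _ => 0) tau V v2 ->
      (fun t => fine (msd P (fun _ => 0) tau V t))
        ~_(pinfty_filter R)
      (fun t => fine (sigma2 F) * v2 * t / fine (taubar F)))
  /\
  (* equilibrium case: T0 has distribution function F0 *)
  (forall (dT : measure_display) (T : measurableType dT) (P : probability T R)
          (T0 : T -> R) (tau : nat -> T -> R) (V : nat -> T -> 'I_d -> R),
      renewal_setup P F T0 tau V v2 ->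
      (forall s, P [set w | T0 w <= s] = (F0 F s)%:E) ->
      (fun t => fine (msd P T0 tau V t))
        ~_(pinfty_filter R)
      (fun t => fine (sigma2 F) * v2 * t / fine (taubar F))).
Proof.
move=> cF F_at0 taubar_fin sigma2_fin; split.
  move=> dT T P tau V setup; apply: msd_equiv => //.
    rewrite (_ : [set w | _] = set0) ?measure0//.
    by apply/seteqP; split=> w //=; rewrite ltxx.
  move=> eps eps0; exists 0 => t t0.
  under eq_Rintegral do rewrite /clip maxxx min_l// expr0n/=.
  by rewrite Rintegral_probability_cst mulr_ge0// ltW.
move=> dT T P T0 tau V setup T0F.
have mT0 : measurable_fun setT T0 by case: setup.
have F00 : F0 F 0 = 0 by rewrite /F0 set_itv1 integral_set1 mul0r.
apply: msd_equiv => //; first by apply: measure_lt0_eq0 => //; rewrite T0F F00.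
have F_le1 := renewal_setup_cdf_le1 setup.
move=> eps eps0.
have [A HA] := equilibrium_trunc_sqr_small cF F_at0 F_le1 taubar_fin sigma2_fin eps0.
exists (Num.max A 0) => t; rewrite ge_max => /andP[At t0].
rewrite (expectation_sqr_min (F := F0 F))//; first exact: HA.
- exact: measurable_maxr.
- by move=> w; exact: clip_ge0.
- exact: clip_cdf.
Qed.
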